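(* Let $\mathcal{G}$ be a compact and connected metric graph of total length $L$ whose doubly connected part has total length $V\in[0,L]$. Let $\mathcal{D}$ be the dumbbell graph of total length $L$ having both loops of length $V/2$. Then $$\lambda_2^N(\mathcal{G})\ge\lambda_2^N(\mathcal{D}).$$
   Context: A compact metric graph has finitely many vertices and edges, each edge $e$ identified with an interval $[0,|e|]$, $0<|e|<\infty$; loops and multiple edges are allowed. All vertices are equipped with natural conditions: functions are continuous at each vertex and the sum of the outward derivatives over all edges at the vertex is zero. For a connected graph, $0=\lambda_1^N<\lambda_2^N\le\lambda_3^N\le\dots$ are the eigenvalues of the Laplacian $-d^2/dx^2$ with these conditions; thus $\lambda_2^N(\mathcal{G})=\inf\{\int_{\mathcal{G}}|f'|^2dx/\int_{\mathcal{G}}|f|^2dx: 0\ne f\in H^1(\mathcal{G}),\ \int_{\mathcal{G}}f\,dx=0\}$, where $H^1(\mathcal{G})$ is the space of continuous functions on $\mathcal{G}$ that are $H^1$ on each edge. The doubly connected part of $\mathcal{G}$ is the closed subgraph consisting of all $x\in\mathcal{G}$ for which there is a non-self-intersecting path in $\mathcal{G}$ starting and ending at $x$; equivalently, it is obtained by deleting every bridge (including pendant edges) and then any isolated vertices. A dumbbell graph consists of an edge (the handle) with a loop attached at each of its two ends; degenerate cases are allowed: here the handle has length $L-V$, so for $V=0$ the dumbbell is a path (interval) of length $L$ and for $V=L$ it is a figure-8 (two loops of length $L/2$ sharing a vertex). *)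

(* Defs.v *)
From HB Require Import structures.
From mathcomp Require Import all_boot all_order all_algebra.
From mathcomp Require Import all_classical all_reals all_analysis.

Set Implicit Arguments.
Unset Strict Implicit.
Unset Printing Implicit Defensive.

Import Order.TTheory GRing.Theory Num.Theory.
Import numFieldNormedType.Exports.

Local Open Scope classical_set_scope.
Local Open Scope ring_scope.

(* The edge e is the interval [0, len e]; its endpoints 0 and len e are glued *)
(* to the vertices src e and tgt e. Loops and multiple edges are allowed, and *)
(* the orientation is only a parametrization.                                 *)
Record metric_graph (R : realType) := MetricGraph {
  vertex : finType;
  edge : finType;
  src : edge -> vertex;
  tgt : edge -> vertex;
  len : edge -> R;
  len_gt0 : forall e, 0 < len e
}.

Section MetricGraph.
Variables (R : realType) (G : metric_graph R).

Definition adjacent : rel (vertex G) := fun u v =>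
  [exists e : edge G, ((src e == u) && (tgt e == v))
                   || ((src e == v) && (tgt e == u))].

Definition connected_graph : Prop :=
  forall u v : vertex G, connect adjacent u v.

Definition total_length : R := \sum_(e : edge G) len e.

(* A dart (e, b) is the edge e traversed from src to tgt if b = true, and     *)
(* from tgt to src otherwise.                                                 *)
Definition dart : Type := (edge G * bool)%type.
Definition dart_src (d : dart) : vertex G := if d.2 then src d.1 else tgt d.1.
Definition dart_tgt (d : dart) : vertex G := if d.2 then tgt d.1 else src d.1.

(* A closed path without self-intersections. Distinctness of the edges only   *)
(* matters for two darts, where it excludes going back along the same edge.   *)
Definition simple_closed_path (c : seq dart) : Prop :=
  [/\ c != [::],
      cycle (fun d1 d2 => dart_tgt d1 == dart_src d2) c,
      uniq (map dart_src c) &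
      uniq (map fst c)].

(* A point in the interior of e starts and ends a non-self-intersecting path  *)
(* iff e lies on a simple closed path; vertices have length zero, so only the *)
(* edges contribute to the length of the doubly connected part.               *)
Definition doubly_connected_edge (e : edge G) : Prop :=
  exists2 c : seq dart, simple_closed_path c & e \in map fst c.

Definition doubly_connected_length : R :=
  \sum_(e : edge G | `[< doubly_connected_edge e >]) len e.

(* A function on G is given by its restrictions f e to the edges; only the    *)
(* values f e x with 0 <= x <= len e are meaningful.                          *)

(* Derivative on [0, l], one-sided at the two endpoints.                      *)
Definition has_derivative_on (l : R) (f df : R -> R) : Prop :=
  forall x : R, 0 <= x <= l ->
    (f y - f x) / (y - x) @[y --> within `[0, l] x^'] --> df x.

Definition continuous_at_vertices (f : edge G -> R -> R) : Prop :=
  exists phi : vertex G -> R,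
    forall e, f e 0 = phi (src e) /\ f e (len e) = phi (tgt e).

(* df is the derivative of a function on G; the outward derivative (from the  *)
(* vertex into the edge) is df e 0 at src e and - df e (len e) at tgt e, and  *)
(* a loop contributes both.                                                   *)
Definition kirchhoff (df : edge G -> R -> R) : Prop :=
  forall v : vertex G,
    \sum_(e : edge G | src e == v) df e 0
    + \sum_(e : edge G | tgt e == v) - df e (len e) = 0.

(* f belongs to the eigenspace for lam of -d^2/dx^2 with natural conditions.  *)
Definition in_eigenspace (lam : R) (f : edge G -> R -> R) : Prop :=
  exists df : edge G -> R -> R,
    [/\ forall e, has_derivative_on (len e) (f e) (df e),
        forall e, has_derivative_on (len e) (df e) (fun x => - (lam * f e x)),
        continuous_at_vertices f &
        kirchhoff df].

Definition linearly_independent (k : nat) (u : 'I_k -> edge G -> R -> R)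
    : Prop :=
  forall c : 'I_k -> R,
    (forall (e : edge G) (x : R), 0 <= x <= len e ->
      \sum_(i < k) c i * u i e x = 0) ->
    forall i, c i = 0.

(* The k-th smallest eigenvalue (k >= 1), counted with multiplicity: the      *)
(* least mu for which the eigenspaces with eigenvalue at most mu have total   *)
(* dimension at least k.                                                      *)
Definition eigenvalue_k (k : nat) : \bar R :=
  ereal_inf [set mu%:E | mu in [set mu : R |
    exists (u : 'I_k -> edge G -> R -> R) (lam : 'I_k -> R),
      linearly_independent u /\
      forall i, in_eigenspace (lam i) (u i) /\ lam i <= mu]].

End MetricGraph.

(* The dumbbell of total length L with both loops of length V / 2. The handle *)
(* is None, the loops are Some false and Some true. Edges of length zero are  *)
(* dropped, and the two ends of the handle are the same vertex unless V < L.  *)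
(* Thus V = 0 < L gives a path, 0 < V = L a figure-8, and L = V = 0 a point.  *)
Section Dumbbell.
Variables (R : realType) (L V : R).

Definition dumbbell_len (o : option bool) : R :=
  if o is Some _ then V / 2 else L - V.

Definition dumbbell_end (b : bool) : 'I_(V < L)%R.+1 :=
  if b then ord_max else ord0.

Definition dumbbell_edge : finType := {o : option bool | 0 < dumbbell_len o}.

Definition dumbbell_src (o : dumbbell_edge) : 'I_(V < L)%R.+1 :=
  if val o is Some b then dumbbell_end b else dumbbell_end false.

Definition dumbbell_tgt (o : dumbbell_edge) : 'I_(V < L)%R.+1 :=
  if val o is Some b then dumbbell_end b else dumbbell_end true.

Definition dumbbell : metric_graph R :=
  @MetricGraph R 'I_(V < L)%R.+1 dumbbell_edge dumbbell_src dumbbell_tgt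
    (fun o => dumbbell_len (val o)) (fun o => valP o).

End Dumbbell.

(* Main.v *)
Require Import Defs.
From HB Require Import structures.
From mathcomp Require Import all_boot all_order all_algebra.
From mathcomp Require Import all_classical all_reals all_analysis.
From mathcomp Require Import ring lra.

(* Let f be an eigenfunction of G for w^2 > 0. On every edge f is             *)
(* A sin (w x + s); cut the edges at the critical points of f. For a level t  *)
(* let H t be the sum of sqrt (A^2 - t^2) over the points of {f = t}, i.e.    *)
(* the total flux |f'| / w through the level set; by Kirchhoff's condition H  *)
(* is continuous. As t runs from min f < 0 to max f > 0, the argument of the  *)
(* point (H t, t) runs from - pi / 2 to pi / 2. If {f = t} is one point, the  *)
(* latter lies on a bridge and the argument moves with the phase of f there.  *)
(* If {f = t} has at least two points, the Cauchy-Schwarz inequality bounds   *)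
(* the speed of the argument of (H t, 2 t) by half the total speed of the     *)
(* phases. Both bounds are combined by means of a function of the argument    *)
(* (a calibration) adapted to the dumbbell: it is the argument itself where   *)
(* the odd eigenfunction of the dumbbell is on the handle, and a multiple of  *)
(* the argument of (H, 2 t) where that eigenfunction is on the loops.         *)
(* Integrating over t compares w with the frequency of the dumbbell.          *)

Set Implicit Arguments.
Unset Strict Implicit.
Unset Printing Implicit Defensive.

Import Order.TTheory GRing.Theory Num.Theory.
Import numFieldNormedType.Exports.

Local Open Scope classical_set_scope.
Local Open Scope ring_scope.

(** * Arguments of points of a half-plane *)

(** The comparison is between phases. An eigenfunction of G for [w ^+ 2] sweeps a phase interval of
    length [w * len e] on the edge e. With weight [calib_slope c / 2] on doubly connected edges and
    1 on bridges, the swept phases add up to [w * (L - V + calib_slope c / 2 * V)]. By [calib_step],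
    [calib c] of the argument of (H t, t) grows by at most the weighted phase swept between
    consecutive levels. Three facts about the graph enter: H is continuous ([flux_continuous],
    Kirchhoff), every level strip is crossed ([cross_exists], connectedness), and a strip crossed
    only once is crossed on a bridge ([single_cross_bridge]). [calib_bound] sums these steps from
    the minimum to the maximum.

    The resulting inequality holds for every c in [0, pi / 2]. Let wD be the frequency of the odd
    eigenfunction of the dumbbell, and take c = wD (L - V) / 2, half the phase of its handle. Its
    matching condition at the vertices says [double_tan c] = pi / 2 - wD V / 4, so the inequality
    reads wD (L - V + [calib_slope c] / 2 V) <= w (L - V + [calib_slope c] / 2 V), whence wD <= w.

    The eigenvalue of the dumbbell only has to be bounded above, by the constant and the odd
    eigenfunction ([dumbbell_eigenvalue_le]). On G, eigenfunctions for eigenvalues <= 0 are constant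
    ([eigenfunction_const]), so two independent ones include one with a positive eigenvalue. *)

Lemma derive_ge0_le (R : realType) (f df : R -> R) (a b : R) :
  a <= b -> {within `[a, b], continuous f} ->
  (forall x, a < x < b -> is_derive x 1 f (df x)) ->
  (forall x, a < x < b -> 0 <= df x) -> f a <= f b.
Proof.
rewrite le_eqVlt => /predU1P[->//|ab] cf fdf df0.
have hd x : x \in `]a, b[ -> is_derive x 1 f (df x) by rewrite in_itv; exact: fdf.
have [c] := MVT ab hd cf; rewrite in_itv /= => cab e; rewrite -subr_ge0 e.
by rewrite mulr_ge0 ?df0 // subr_ge0 ltW.
Qed.

Lemma derive_ge0_le_continuous (R : realType) (f df : R -> R) (a b : R) :
  a <= b -> (forall x, a <= x <= b -> {for x, continuous f}) ->
  (forall x, a < x < b -> is_derive x 1 f (df x)) ->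
  (forall x, a < x < b -> 0 <= df x) -> f a <= f b.
Proof.
move=> ab cf; apply: derive_ge0_le => //.
by apply: continuous_in_subspaceT => x; rewrite inE /= in_itv /=; exact: cf.
Qed.

Section Angle.
Variable R : realType.
Implicit Types x y r t theta : R.

(* The argument of the point (x, y) in the half-plane 0 <= x; the half-angle  *)
(* formula stays smooth on the axis x = 0.                                    *)
Definition ang x y : R := 2 * atan (y / (x + Num.sqrt (x ^+ 2 + y ^+ 2))).

Lemma ang_cos_sin theta : - (pi / 2) <= theta <= pi / 2 ->
  ang (cos theta) (sin theta) = theta.
Proof.
move=> /andP[t1 t2]; have p0 := pi_gt0 R; rewrite /ang cos2Dsin2 sqrtr1.
set h := theta / 2; have -> : theta = h *+ 2 by rewrite /h; lra.
have ch : 0 < cos h by apply: cos_gt0_pihalf; rewrite /h; lra.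
rewrite cos_mulr2n sin_mulr2n.
have -> : (cos h * sin h) *+ 2 / (cos h ^+ 2 *+ 2 - 1 + 1) = tan h.
  by rewrite subrK /tan; field; rewrite gt_eqF.
rewrite tanK ?mulr_natl // in_itv /=; rewrite /h; lra.
Qed.

Lemma ang_scale r x y : 0 < r -> ang (r * x) (r * y) = ang x y.
Proof.
move=> r0; rewrite /ang; congr (_ * atan _).
rewrite !exprMn -mulrDr sqrtrM ?sqr_ge0 // sqrtr_sqr gtr0_norm // -mulrDr.
rewrite invfM mulrACA divff ?mul1r //; lra.
Qed.

Lemma polarP x y : 0 <= x -> 0 < x ^+ 2 + y ^+ 2 ->
  exists r theta, [/\ 0 < r, - (pi / 2) <= theta <= pi / 2,
    x = r * cos theta & y = r * sin theta].
Proof.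
move=> x0 s0; set r := Num.sqrt (x ^+ 2 + y ^+ 2).
have r0 : 0 < r by rewrite sqrtr_gt0.
have r2 : r ^+ 2 = x ^+ 2 + y ^+ 2 by rewrite sqr_sqrtr // ltW.
have q : (y / r) ^+ 2 = 1 - (x / r) ^+ 2.
  by rewrite !expr_div_n r2; field; lra.
have yr : -1 <= y / r <= 1.
  by rewrite -ler_norml -(@ler_pXn2r _ 2) ?nnegrE // expr1n real_normK ?num_real // q gerBl sqr_ge0.
exists r, (asin (y / r)); split => //.
- by rewrite asin_geNpi2 // asin_lepi2.
- rewrite cos_asin // q opprB addrCA subrr addr0 sqrtr_sqr ger0_norm ?divr_ge0 ?(ltW r0) //.
  by rewrite mulrC divfK // gt_eqF.
- by rewrite asinK ?in_itv // mulrC divfK // gt_eqF.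
Qed.

Lemma ang_bound x y : 0 <= x -> 0 < x ^+ 2 + y ^+ 2 ->
  - (pi / 2) <= ang x y <= pi / 2.
Proof.
by move=> x0 /(polarP x0)[r [th [r0 thb -> ->]]]; rewrite ang_scale // ang_cos_sin.
Qed.

Lemma ang_denom_gt0 x y : 0 <= x -> 0 < x ^+ 2 + y ^+ 2 ->
  0 < x + Num.sqrt (x ^+ 2 + y ^+ 2).
Proof. by move=> x0 s0; rewrite ltr_wpDl // sqrtr_gt0. Qed.

Lemma is_derive_ang (X Y : R -> R) t dX dY :
  is_derive t 1 X dX -> is_derive t 1 Y dY ->
  0 <= X t -> 0 < X t ^+ 2 + Y t ^+ 2 ->
  is_derive t 1 (fun u => ang (X u) (Y u))
    ((X t * dY - Y t * dX) / (X t ^+ 2 + Y t ^+ 2)).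
Proof.
move=> hX hY x0 s0; have d0 := ang_denom_gt0 x0 s0.
pose S := (X ^+ 2 + Y ^+ 2)%R.
have hS : is_derive t 1 S ((X t * dX + Y t * dY) *+ 2).
  apply: is_derive_eq; rewrite /GRing.scale /=; ring.
have hs : is_derive t 1 (Num.sqrt \o S)
    ((2 * Num.sqrt (S t))^-1 * ((X t * dX + Y t * dY) *+ 2)).
  by apply: is_derive1_comp; exact: is_derive1_sqrt.
pose D := (X + (Num.sqrt \o S))%R.
have hD : is_derive t 1 D
    (dX + (2 * Num.sqrt (S t))^-1 * ((X t * dX + Y t * dY) *+ 2)).
  exact: is_deriveD.
have hV := @is_deriveV R D t _ _ (lt0r_neq0 d0) hD.
have hq := is_deriveM hY hV.
have ha := is_derive1_comp (is_derive1_atan _) hq.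
have hz := @is_deriveZ R _ _ _ 2 t 1 _ ha.
apply: is_derive_eq => /=.
rewrite /GRing.scale /= /S /=.
have -> : D t = X t + Num.sqrt (X t ^+ 2 + Y t ^+ 2) by [].
have -> : (X ^+ 2 + Y ^+ 2)%R t = X t ^+ 2 + Y t ^+ 2 by [].
move: d0; set r := Num.sqrt _ => d0.
have r2 : r ^+ 2 = X t ^+ 2 + Y t ^+ 2 by rewrite sqr_sqrtr // ltW.
have r0 : 0 < r by rewrite sqrtr_gt0.
rewrite -r2; set x := X t in x0 d0 r2 *; set y := Y t in r2 *.
have y2 : y ^+ 2 = r ^+ 2 - x ^+ 2 by rewrite r2; ring.
have -> : 1 + (y * (x + r)^-1) ^+ 2 = 2 * r / (x + r).
  by rewrite exprMn y2; field; lra.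
apply/eqP; rewrite -subr_eq0; apply/eqP.
transitivity ((r ^+ 2 - x ^+ 2 - y ^+ 2) * dY / (r ^+ 2 * (x + r))).
  by field; lra.
by rewrite y2 subrr !mul0r.
Qed.

Lemma continuous_ang (X Y : R -> R) t :
  {for t, continuous X} -> {for t, continuous Y} ->
  0 <= X t -> 0 < X t ^+ 2 + Y t ^+ 2 ->
  {for t, continuous (fun u => ang (X u) (Y u))}.
Proof.
move=> cX cY x0 s0; have d0 := ang_denom_gt0 x0 s0.
have cS : {for t, continuous (fun u => X u ^+ 2 + Y u ^+ 2)}.
  by apply: continuousD; apply: continuousM.
have cs : {for t, continuous (fun u => Num.sqrt (X u ^+ 2 + Y u ^+ 2))}.
  by apply: (@continuous_comp _ _ _ _ Num.sqrt) => //; exact: sqrt_continuous.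
have cD := continuousD cX cs.
have cV : {for t, continuous (fun u => (X u + Num.sqrt (X u ^+ 2 + Y u ^+ 2))^-1)}.
  by apply: continuousV => //; exact: lt0r_neq0.
have cq := continuousM cY cV.
have ca := continuous_comp cq (@continuous_atan R _).
by apply: continuousM => //; exact: cst_continuous.
Qed.

End Angle.

(** * The calibration and the flux through a level *)

Section AngleMore.
Variable R : realType.
Implicit Types x y t : R.

Lemma ang_opp x y : ang x (- y) = - ang x y.
Proof. by rewrite /ang sqrrN mulNr atanN mulrN. Qed.

Lemma ang_pihalf y : 0 < y -> ang 0 y = pi / 2.
Proof.
move=> y0; have p0 := pi_gt0 R.
rewrite -(@ang_cos_sin R (pi / 2)); last by lra.
by rewrite cos_pihalf sin_pihalf -(ang_scale 0 1 y0) mulr0 mulr1.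
Qed.

Lemma ler_sin x y : - (pi / 2) <= x -> x <= y -> y <= pi / 2 -> sin x <= sin y.
Proof.
move=> hx xy hy; rewrite leNgt ltr_sin ?in_itv /=.
- by rewrite -leNgt.
- by rewrite hy (le_trans hx).
- by rewrite hx (le_trans xy).
Qed.

Lemma sqr_sin_le x y : 0 <= y <= pi / 2 -> - y <= x <= y ->
  sin x ^+ 2 <= sin y ^+ 2.
Proof.
move=> /andP[y0 y1] /andP[x0 x1].
have h1 : sin x <= sin y by apply: ler_sin => //; lra.
have h2 : sin (- x) <= sin y by apply: ler_sin => //; lra.
rewrite sinN in h2; nra.
Qed.

Lemma is_derive_bigsum (I : Type) (s : seq I) (P : pred I)
    (h : I -> R -> R) (dh : I -> R) t :
  (forall i, P i -> is_derive t 1 (h i) (dh i)) ->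
  is_derive t 1 (fun u => \sum_(i <- s | P i) h i u) (\sum_(i <- s | P i) dh i).
Proof.
move=> hd; elim: s => [|i s ih].
  rewrite big_nil; under eq_fun do rewrite big_nil.
  exact: is_derive_cst.
rewrite big_cons; under eq_fun do rewrite big_cons.
by case: ifP => // Pi; apply: is_deriveD => //; exact: hd.
Qed.

Lemma continuous_bigsum (I : Type) (s : seq I) (P : pred I)
    (h : I -> R -> R) t :
  (forall i, P i -> {for t, continuous (h i)}) ->
  {for t, continuous (fun u => \sum_(i <- s | P i) h i u)}.
Proof.
move=> hc; elim: s => [|i s ih].
  have -> : (fun u => \sum_(i <- [::] | P i) h i u) = cst 0.
    by apply/funext => u; rewrite big_nil.
  exact: cst_continuous.
have -> : (fun u => \sum_(j <- i :: s | P j) h j u) =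
    (fun u => if P i then h i u + \sum_(j <- s | P j) h j u
              else \sum_(j <- s | P j) h j u).
  by apply/funext => u; rewrite big_cons.
by case: (P i) (hc i) => // /(_ isT) hi; apply: continuousD.
Qed.

End AngleMore.

Section Calibration.
Variable R : realType.
Implicit Types a b c : R.

(* If [a] is the argument of (H, t), then [double_tan a] is that of (H, 2 t). *)
Definition double_tan a : R := ang (cos a) (2 * sin a).

Lemma double_tan_opp a : double_tan (- a) = - double_tan a.
Proof. by rewrite /double_tan cosN sinN mulrN ang_opp. Qed.

Lemma double_tan_pihalf : double_tan (pi / 2) = pi / 2.
Proof. by rewrite /double_tan cos_pihalf sin_pihalf ang_pihalf //; lra. Qed.

Lemma double_tan_pos a : 0 < cos a ^+ 2 + (2 * sin a) ^+ 2.
Proof.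
rewrite cos2sin2 exprMn; have := sqr_ge0 (sin a); lra.
Qed.

Lemma is_derive_double_tan a : - (pi / 2) <= a <= pi / 2 ->
  is_derive a 1 double_tan (2 / (1 + 3 * sin a ^+ 2)).
Proof.
move=> ha; have := sqr_ge0 (sin a) => s0.
have hs : is_derive a 1 (fun u : R => 2 * sin u) (2 * cos a).
  exact: (@is_deriveZ R _ _ _ 2 a 1 _ (is_derive_sin a)).
have := is_derive_ang (is_derive_cos a) hs (cos_ge0_pihalf ha) (double_tan_pos a).
move=> h; apply: is_derive_eq.
have -> : cos a * (2 * cos a) - 2 * sin a * - sin a = 2.
  have := cos2Dsin2 a; lra.
by congr (_ / _); have := cos2Dsin2 a; lra.
Qed.

(** Normalized so that [calib_slope c * double_tan] has slope 1 exactly at the arguments c and - c,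
    where the two bounds on [calib] change roles. *)
Definition calib_slope c : R := (1 + 3 * sin c ^+ 2) / 2.

Lemma calib_slope_ge c : 1 / 2 <= calib_slope c.
Proof. rewrite /calib_slope; have := sqr_ge0 (sin c); lra. Qed.

Lemma calib_slope_le c : calib_slope c <= 2.
Proof.
rewrite /calib_slope; have := cos2Dsin2 c; have := sqr_ge0 (cos c); lra.
Qed.

Lemma continuous_double_tan a : - (pi / 2) <= a <= pi / 2 ->
  {for a, continuous double_tan}.
Proof.
move=> ha; apply: continuous_ang; last exact: double_tan_pos.
- exact: continuous_cos.
- by apply: continuousM; [exact: cst_continuous|exact: continuous_sin].
- exact: cos_ge0_pihalf.
Qed.

(** The sign of the derivative is that of [sin c ^+ 2 - sin a ^+ 2]: the rescaled [double_tan] moves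
    faster than the identity for |a| < c and slower beyond. *)
Lemma is_derive_calib_gap c a : - (pi / 2) <= a <= pi / 2 ->
  is_derive a 1 (fun u => calib_slope c * double_tan u - u)
    (3 * (sin c ^+ 2 - sin a ^+ 2) / (1 + 3 * sin a ^+ 2)).
Proof.
move=> ha; have := sqr_ge0 (sin a) => s0.
have h1 := @is_deriveZ R _ _ _ (calib_slope c) a 1 _ (is_derive_double_tan ha).
have h2 := is_deriveB h1 (is_derive_id a 1).
apply: (is_derive_eq h2); rewrite /calib_slope /GRing.scale /=; field; lra.
Qed.

Lemma continuous_calib_gap c a : - (pi / 2) <= a <= pi / 2 ->
  {for a, continuous (fun u => calib_slope c * double_tan u - u)}.
Proof.
move=> ha; apply: continuousB => //.
by apply: continuousM; [exact: cst_continuous|exact: continuous_double_tan].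
Qed.

Lemma calib_gap_inner c a b : 0 <= c <= pi / 2 ->
  - c <= a -> a <= b -> b <= c ->
  b - a <= calib_slope c * (double_tan b - double_tan a).
Proof.
move=> /andP[h0 h1] ha ab hb.
suff : calib_slope c * double_tan a - a <= calib_slope c * double_tan b - b.
  lra.
apply: (@derive_ge0_le_continuous R
  (fun u => calib_slope c * double_tan u - u)
  (fun u => 3 * (sin c ^+ 2 - sin u ^+ 2) / (1 + 3 * sin u ^+ 2)) _ _ ab) => u hu.
- apply: continuous_calib_gap; lra.
- apply: is_derive_calib_gap; lra.
- apply: divr_ge0; last by have := sqr_ge0 (sin u); lra.
  by rewrite mulr_ge0 // subr_ge0; apply: sqr_sin_le; lra.
Qed.

Lemma calib_gap_outer c a b : 0 <= c <= pi / 2 ->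
  c <= a -> a <= b -> b <= pi / 2 ->
  calib_slope c * (double_tan b - double_tan a) <= b - a.
Proof.
move=> /andP[h0 h1] ha ab hb.
suff : - (calib_slope c * double_tan a - a) <= - (calib_slope c * double_tan b - b).
  lra.
apply: (@derive_ge0_le_continuous R
  (fun u => - (calib_slope c * double_tan u - u))
  (fun u => - (3 * (sin c ^+ 2 - sin u ^+ 2) / (1 + 3 * sin u ^+ 2))) _ _ ab) => u hu.
- by apply: continuousN; apply: continuous_calib_gap; lra.
- by apply: is_deriveN; apply: is_derive_calib_gap; lra.
- rewrite -mulNr; apply: divr_ge0; last by have := sqr_ge0 (sin u); lra.
  have : sin c ^+ 2 <= sin u ^+ 2 by apply: sqr_sin_le; lra.
  lra.
Qed.

(* The increments of [calib c] are bounded both by those of the identity and *)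
(* by those of [calib_slope c * double_tan], with equality along the level   *)
(* sets of the dumbbell: the first bound is sharp on its handle |a| <= c,    *)
(* the second one on its loops.                                               *)
Definition calib c a : R :=
  if a < - c then - c + calib_slope c * (double_tan a + double_tan c)
  else if a <= c then a
  else c + calib_slope c * (double_tan a - double_tan c).

Lemma calib_increment c a b : 0 <= c <= pi / 2 ->
  - (pi / 2) <= a -> a <= b -> b <= pi / 2 ->
  calib c b - calib c a <= b - a /\
  calib c b - calib c a <= calib_slope c * (double_tan b - double_tan a).
Proof.
move=> h0 ha ab hb.
have outN u v : u <= v -> v <= - c -> - (pi / 2) <= u ->
    calib_slope c * (double_tan v - double_tan u) <= v - u.
  move=> uv va up; have := @calib_gap_outer c (- v) (- u) h0.
  rewrite !double_tan_opp; lra.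
have h := @calib_gap_outer c _ _ h0.
have k := @calib_gap_inner c _ _ h0.
have oN := double_tan_opp c.
have [h01 h02] := andP h0.
rewrite /calib; case: (ltP b (- c)) => b1; case: (ltP a (- c)) => a1.
- by have := outN a b ab; lra.
- lra.
- have e1 := outN a (- c); case: (leP b c) => b2.
    by have := k (- c) b; rewrite oN in e1 *; lra.
  have := k (- c) c; have := h c b; rewrite oN in e1 *; lra.
- case: (leP b c) => b2; case: (leP a c) => a2.
  + by have := k a b; lra.
  + lra.
  + have := k a c; have := h c b; lra.
  + have := h a b; lra.
Qed.

Lemma calib_pihalf c : 0 <= c <= pi / 2 ->
  calib c (pi / 2) = c + calib_slope c * (pi / 2 - double_tan c).
Proof.
move=> /andP[h0 h1]; have p0 := pi_gt0 R.
rewrite /calib ltNge (_ : - c <= pi / 2) /=; last by lra.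
case: leP => h2; last by rewrite double_tan_pihalf.
have -> : c = pi / 2 by lra.
by rewrite double_tan_pihalf subrr mulr0 addr0.
Qed.

Lemma calib_Npihalf c : 0 <= c <= pi / 2 ->
  calib c (- (pi / 2)) = - (c + calib_slope c * (pi / 2 - double_tan c)).
Proof.
move=> /andP[h0 h1]; have p0 := pi_gt0 R.
rewrite /calib; case: ltP => h2.
  rewrite double_tan_opp double_tan_pihalf; lra.
have -> : c = pi / 2 by lra.
by rewrite double_tan_pihalf subrr mulr0 addr0; case: leP; lra.
Qed.

End Calibration.

(** * The flux through a level and its argument *)

Section Flux.
Variables (R : realType) (I : finType) (P : pred I) (A : I -> R).
Implicit Types a b t : R.

Definition flux t : R := \sum_(i | P i) Num.sqrt (A i ^+ 2 - t ^+ 2).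

Lemma flux_ge0 t : 0 <= flux t.
Proof. by apply: sumr_ge0 => i _; exact: sqrtr_ge0. Qed.

Lemma continuous_amp (c t : R) : {for t, continuous (fun u : R => Num.sqrt (c ^+ 2 - u ^+ 2))}.
Proof.
apply: (@continuous_comp _ _ _ _ Num.sqrt); last exact: sqrt_continuous.
by apply: continuousB; [exact: cst_continuous|apply: continuousM].
Qed.

Lemma continuous_flux t : {for t, continuous flux}.
Proof. by apply: continuous_bigsum => i _; exact: continuous_amp. Qed.

Lemma sqr_amp_gt0 (c t : R) : - c < t < c -> 0 < c ^+ 2 - t ^+ 2.
Proof. by move=> /andP[h1 h2]; nra. Qed.

Lemma is_derive_amp (c t : R) : - c < t < c ->
  is_derive t 1 (fun u : R => Num.sqrt (c ^+ 2 - u ^+ 2))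
    (- t / Num.sqrt (c ^+ 2 - t ^+ 2)).
Proof.
move=> ht; have d0 := sqr_amp_gt0 ht.
have h1 : is_derive t 1 ((cst (c ^+ 2) : R -> R) - id ^+ 2 : R -> R) (- (t *+ 2)).
  by apply: is_derive_eq; rewrite /GRing.scale /=; ring.
have h := @is_derive1_comp R Num.sqrt _ t _ _ (@is_derive1_sqrt R _ d0) h1.
apply: (is_derive_eq h).
have s0 : 0 < Num.sqrt (c ^+ 2 - t ^+ 2) by rewrite sqrtr_gt0.
rewrite /GRing.scale /=.
by field; rewrite gt_eqF.
Qed.

Hypothesis Pex : exists i, P i.

(** The only doubtful level is t = 0, where the flux is the sum of the |A i|; these are nonzero
    because [a, b] has positive length and lies in [- A i, A i]. *)
Lemma flux_pos k a b t : 0 < k -> (forall i, P i -> - A i <= a /\ b <= A i) ->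
  a < b -> a <= t <= b -> 0 < flux t ^+ 2 + (k * t) ^+ 2.
Proof.
move=> k0 hA ab ht; have [->|t0] := eqVneq t 0.
  rewrite mulr0 expr0n addr0 exprn_gt0 //; have [i Pi] := Pex.
  rewrite /flux (bigD1 i) //= expr0n subr0 sqrtr_sqr ltr_pwDl ?normr_gt0 //.
    by have [h1 h2] := hA _ Pi; apply/eqP => h0; lra.
  by apply: sumr_ge0 => j _; exact: sqrtr_ge0.
by rewrite ltr_wpDl ?sqr_ge0 // exprn_even_gt0 //= mulf_neq0 // gt_eqF.
Qed.

Lemma is_derive_flux_ang k a b t : 0 < k ->
  (forall i, P i -> - A i <= a /\ b <= A i) -> a < t < b ->
  let S := \sum_(i | P i) (Num.sqrt (A i ^+ 2 - t ^+ 2))^-1 in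
  is_derive t 1 (fun u => ang (flux u) (k * u))
    (k * (flux t + t ^+ 2 * S) / (flux t ^+ 2 + (k * t) ^+ 2)).
Proof.
move=> k0 hA /andP[at_ tb] S.
have ab : a < b by lra.
have hf : is_derive t 1 flux (- t * S).
  rewrite /S mulr_sumr; apply: is_derive_bigsum => i Pi.
  by apply: is_derive_amp; have := hA _ Pi; lra.
have hk : is_derive t 1 (fun u : R => k * u) k.
  have h := @is_deriveZ R _ _ _ k t 1 _ (is_derive_id t 1).
  by apply: (is_derive_eq h); rewrite /GRing.scale /= mulr1.
have ht : a <= t <= b by rewrite !ltW.
have h := is_derive_ang hf hk (flux_ge0 t) (flux_pos k0 hA ab ht).
apply: (is_derive_eq h); congr (_ / _); ring.
Qed.

Lemma continuous_flux_ang k a b t : 0 < k ->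
  (forall i, P i -> - A i <= a /\ b <= A i) -> a < b -> a <= t <= b ->
  {for t, continuous (fun u => ang (flux u) (k * u))}.
Proof.
move=> k0 hA ab ht; apply: continuous_ang.
- exact: continuous_flux.
- by apply: continuousM => //; exact: cst_continuous.
- exact: flux_ge0.
- exact: flux_pos hA ab ht.
Qed.

Lemma flux_ang_nondecreasing a b :
  (forall i, P i -> - A i <= a /\ b <= A i) -> a < b ->
  ang (flux a) a <= ang (flux b) b.
Proof.
move=> hA ab; rewrite -[X in ang (flux a) X]mul1r -[X in ang (flux b) X]mul1r.
apply: (@derive_ge0_le_continuous R (fun u => ang (flux u) (1 * u))
  (fun u => 1 * (flux u + u ^+ 2 * \sum_(i | P i) (Num.sqrt (A i ^+ 2 - u ^+ 2))^-1)
            / (flux u ^+ 2 + (1 * u) ^+ 2)) _ _ (ltW ab)) => t ht.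
- exact: continuous_flux_ang hA ab ht.
- exact: is_derive_flux_ang hA ht.
- apply: divr_ge0; last by rewrite addr_ge0 ?sqr_ge0.
  rewrite mul1r addr_ge0 ?flux_ge0 // mulr_ge0 ?sqr_ge0 //.
  by apply: sumr_ge0 => i _; rewrite invr_ge0 sqrtr_ge0.
Qed.

End Flux.

(** * Levels met in at least two points *)

Section TwoBranches.
Variables (R : realType) (I : finType) (P : pred I) (A : I -> R).

Lemma sum_ge_pair (F : I -> R) i j : P i -> P j -> i != j ->
  (forall k, P k -> 0 <= F k) -> F i + F j <= \sum_(k | P k) F k.
Proof.
move=> Pi Pj ij F0; rewrite (bigD1 i) //= (bigD1 j) /=; last by rewrite Pj eq_sym.
rewrite addrA lerDl; apply: sumr_ge0 => k /andP[/andP[Pk _] _]; exact: F0.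
Qed.

(* The derivative of the difference has the sign of                           *)
(* (\sum_i s i) * (\sum_i (s i)^-1) - 4, where s i = sqrt (A i ^+ 2 - t ^+ 2). *)
Lemma flux_double_ang_increment (a b : R) i j : P i -> P j -> i != j ->
  (forall i, P i -> - A i <= a /\ b <= A i) -> a < b ->
  ang (flux P A b) (2 * b) - ang (flux P A a) (2 * a) <=
  \sum_(k | P k) (ang (Num.sqrt (A k ^+ 2 - b ^+ 2)) b
                  - ang (Num.sqrt (A k ^+ 2 - a ^+ 2)) a) / 2.
Proof.
move=> Pi Pj ij hA ab.
have Pex : exists i, P i by exists i.
have p2 : (0 : R) < 2 by lra.
pose g (k : I) (t : R) := ang (flux (pred1 k) A t) (1 * t).
have gE k t : g k t = ang (Num.sqrt (A k ^+ 2 - t ^+ 2)) t.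
  by rewrite /g /flux big_pred1_eq mul1r.
pose f t := 2^-1 * \sum_(k | P k) g k t - ang (flux P A t) (2 * t).
have exk (k : I) : exists l : I, pred1 k l by exists k; rewrite /= eqxx.
have hAk k : P k -> forall l, pred1 k l -> - A l <= a /\ b <= A l.
  by move=> Pk l /eqP ->; exact: hA.
suff : f a <= f b.
  rewrite /f -mulr_suml sumrB; under eq_bigr do rewrite gE.
  under [X in _ <= _ * X - _]eq_bigr do rewrite gE; lra.
pose S t := \sum_(k | P k) (Num.sqrt (A k ^+ 2 - t ^+ 2))^-1.
apply: (@derive_ge0_le_continuous R f (fun t => 2^-1 * S t -
   2 * (flux P A t + t ^+ 2 * S t) / (flux P A t ^+ 2 + (2 * t) ^+ 2))
   _ _ (ltW ab)) => t ht.
- apply: continuousB; last exact: continuous_flux_ang hA ab ht.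
  apply: continuousM; first exact: cst_continuous.
  apply: continuous_bigsum => k Pk.
  by apply: continuous_flux_ang (hAk k Pk) ab ht.
- apply: is_deriveB; last exact: is_derive_flux_ang hA ht.
  apply: (@is_deriveZ R _ _ (fun t => \sum_(k | P k) g k t) 2^-1 t 1).
  apply: is_derive_bigsum => k Pk.
  have h := is_derive_flux_ang (exk k) ltr01 (hAk k Pk) ht.
  apply: (is_derive_eq h); rewrite /flux !big_pred1_eq.
  have : 0 < Num.sqrt (A k ^+ 2 - t ^+ 2).
    by rewrite sqrtr_gt0; apply: sqr_amp_gt0; have := hA _ Pk; lra.
  set s := Num.sqrt _ => s0.
  by field; rewrite (gt_eqF s0) gt_eqF // ltr_pwDl ?exprn_gt0 ?sqr_ge0.
- set H := flux P A t.
  have s0 k : P k -> 0 < Num.sqrt (A k ^+ 2 - t ^+ 2).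
    by move=> Pk; rewrite sqrtr_gt0; apply: sqr_amp_gt0; have := hA _ Pk; lra.
  have hH := sum_ge_pair Pi Pj ij (fun k Pk => ltW (s0 k Pk)).
  have hS : (Num.sqrt (A i ^+ 2 - t ^+ 2))^-1 + (Num.sqrt (A j ^+ 2 - t ^+ 2))^-1
     <= S t.
    by apply: (sum_ge_pair Pi Pj ij) => k Pk; rewrite invr_ge0 ltW // s0.
  rewrite -/(flux P A t) -/H in hH.
  move: hH hS (s0 _ Pi) (s0 _ Pj).
  set x := Num.sqrt _; set y := Num.sqrt _ => hH hS x0 y0.
  (* Cauchy-Schwarz for two branches; any further branches only enlarge both factors. *)
  have xy4 : 4 <= (x + y) * (x^-1 + y^-1).
    rewrite -subr_ge0.
    have -> : (x + y) * (x^-1 + y^-1) - 4 = (x - y) ^+ 2 / (x * y) by field; lra.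
    by rewrite divr_ge0 ?sqr_ge0 // mulr_ge0 // ltW.
  have ix : 0 < x^-1 by rewrite invr_gt0.
  have iy : 0 < y^-1 by rewrite invr_gt0.
  have HS4 : 4 <= H * S t.
    apply: (le_trans xy4); apply: ler_pM => //; lra.
  have H0 : 0 < H by lra.
  have d0 : 0 < H ^+ 2 + (2 * t) ^+ 2 by rewrite ltr_pwDl ?sqr_ge0 ?exprn_gt0.
  have -> : 2^-1 * S t - 2 * (H + t ^+ 2 * S t) / (H ^+ 2 + (2 * t) ^+ 2)
      = H * (H * S t - 4) / (2 * (H ^+ 2 + (2 * t) ^+ 2)).
    by field; rewrite gt_eqF.
  by rewrite divr_ge0 ?mulr_ge0 ?subr_ge0 // ltW.
Qed.

End TwoBranches.

(** * Monotone pieces of a sine *)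

(** Induction on the number of elements of [S] strictly between the endpoints. It carries estimates
    from neighbouring levels, between which the set of crossing branches is fixed, to arbitrary
    levels. *)
Lemma consecutive_ind (R : realDomainType) (S : seq R) (Q : R -> R -> Prop) :
  (forall a b, a \in S -> b \in S -> a < b ->
    (forall s, s \in S -> (s <= a) || (b <= s)) -> Q a b) ->
  (forall a b c, a < b -> b < c -> Q a b -> Q b c -> Q a c) ->
  forall a b, a \in S -> b \in S -> a < b -> Q a b.
Proof.
move=> Qc Qt a b; have [n] := ubnP (count (fun s => a < s < b) S).
elim: n a b => // n ih a b; rewrite ltnS => cn aS bS ab.
have [/hasP[s sS /andP[as_ sb]]|no] := boolP (has (fun s => a < s < b) S); last first.
  apply: Qc => // s sS; rewrite !leNgt -negb_and.
  by apply: contra no => /andP[? ?]; apply/hasP; exists s => //; apply/andP.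
have sub (P1 : pred R) : (forall x, P1 x -> a < x < b) -> ~~ P1 s ->
    (count P1 S < n)%N.
  move=> P1s P1N; apply: leq_trans cn.
  have -> : count P1 S = count (predI P1 (fun x => a < x < b)) S.
    by apply: eq_count => x /=; case e: (P1 x) => //=; rewrite P1s.
  rewrite -[X in (_ < X)%N](size_filter) -(count_predC P1) count_filter.
  rewrite -addn1 leq_add2l -has_count; apply/hasP; exists s => //.
  by rewrite mem_filter as_ sb.
by apply: (Qt a s b) => //; apply: ih => //; apply: sub => [x /andP[h1 h2]|];
  rewrite ?ltxx ?andbF //; apply/andP; split=> //; lra.
Qed.

Lemma addb_telescope n (sd : nat -> bool) :
  \big[addb/false]_(k < n) (sd k (+) sd k.+1) = sd 0%N (+) sd n.
Proof.
elim: n => [|n ih]; first by rewrite big_ord0 addbb.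
by rewrite big_ord_recr /= ih addbA -(addbA (sd 0%N)) addbb addbF.
Qed.

Section Piece.
Variable R : realType.
Implicit Types (A x y t : R) (k : nat).

Definition amp A t : R := Num.sqrt (A ^+ 2 - t ^+ 2).

(** For 0 < A and |t| <= A this is arcsin (t / A), the phase at which an increasing branch of A sin
    reaches the level t. *)
Definition lev A t : R := ang (amp A t) t.

Lemma amp_opp A t : amp A (- t) = amp A t.
Proof. by rewrite /amp sqrrN. Qed.

Lemma lev_opp A t : lev A (- t) = - lev A t.
Proof. by rewrite /lev amp_opp ang_opp. Qed.

Lemma amp_sin A x : 0 <= A -> - (pi / 2) <= x <= pi / 2 ->
  amp A (A * sin x) = A * cos x.
Proof.
move=> A0 hx; rewrite /amp.
have -> : A ^+ 2 - (A * sin x) ^+ 2 = (A * cos x) ^+ 2.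
  by rewrite !exprMn cos2sin2; ring.
by rewrite sqrtr_sqr ger0_norm // mulr_ge0 // cos_ge0_pihalf.
Qed.

Lemma lev_sin A x : 0 < A -> - (pi / 2) <= x <= pi / 2 -> lev A (A * sin x) = x.
Proof. by move=> A0 hx; rewrite /lev amp_sin ?(ltW A0) // ang_scale // ang_cos_sin. Qed.

Definition half_wave k x := k%:R * pi - pi / 2 <= x <= k%:R * pi + pi / 2.

(* The two cases are those of an even and of an odd [k].                      *)
Lemma half_waveP A k x y : 0 <= A -> x <= y -> half_wave k x -> half_wave k y ->
  let z := A * sin x in let w := A * sin y in
  [/\ z <= w, A * cos x = amp A z, A * cos y = amp A w &
      0 < A -> lev A w - lev A z = y - x] \/
  [/\ w <= z, A * cos x = - amp A z, A * cos y = - amp A w &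
      0 < A -> lev A z - lev A w = y - x].
Proof.
move=> A0 xy hx hy /=; rewrite /half_wave in hx hy.
set x' := x - k%:R * pi; set y' := y - k%:R * pi.
have ex : x = x' + pi *+ k by rewrite /x' -[pi *+ k]mulr_natl subrK.
have ey : y = y' + pi *+ k by rewrite /y' -[pi *+ k]mulr_natl subrK.
have hx' : - (pi / 2) <= x' <= pi / 2 by rewrite /x'; lra.
have hy' : - (pi / 2) <= y' <= pi / 2 by rewrite /y'; lra.
have xy' : x' <= y' by rewrite /x' /y'; lra.
have s' : A * sin x' <= A * sin y'.
  by apply: ler_wpM2l => //; apply: ler_sin; lra.
have -> : y - x = y' - x' by rewrite /x' /y'; lra.
clearbody x' y'; rewrite ex ey.
rewrite !(alternatingn (@sinDpi R)) !(alternatingn (@cosDpi R)).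
rewrite -signr_odd; case: (odd k) => /=; rewrite ?expr0 ?expr1 ?mul1r ?mulN1r ?mulrN.
  right; rewrite !amp_opp !lev_opp !amp_sin // lerN2; split => // A1.
  by rewrite !lev_sin //; lra.
left; rewrite !amp_sin //; split => // A1.
by rewrite !lev_sin.
Qed.

(** The left side is the contribution of one monotone piece to the jump of the flux at t. The piece
    enters the flux at its lower end and leaves it at its upper end; in terms of the signed
    derivative A cos this becomes start minus end, whether the piece rises or falls. *)
Lemma piece_jump A x y t : 0 <= A -> x <= y ->
  x = y \/ (exists k, half_wave k x /\ half_wave k y) ->
  let z := A * sin x in let w := A * sin y in
  (Num.min z w <= t < Num.max z w)%R%:R * amp A t
    - (Num.min z w < t <= Num.max z w)%R%:R * amp A t
  = (z == t)%:R * (A * cos x) - (w == t)%:R * (A * cos y).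
Proof.
move=> A0 xy [->|[k [hx hy]]] /=.
  rewrite minxx maxxx; case: ltgtP => _ /=; lra.
have key z w : z <= w ->
    (z <= t < w)%R%:R * amp A t - (z < t <= w)%R%:R * amp A t
    = (z == t)%:R * amp A z - (w == t)%:R * amp A w.
  move=> zw; case: (ltgtP z t) => [zt|zt|<-]; case: (ltgtP w _) => [wt|wt|wt] //=;
    rewrite ?mul0r ?mul1r ?subrr ?subr0 ?sub0r // ?wt //; lra.
have [[zw -> -> _]|[wz -> -> _]] := half_waveP A0 xy hx hy.
  rewrite (min_idPl zw) (max_idPr zw); exact: key.
by rewrite (min_idPr wz) (max_idPl wz) key //; lra.
Qed.

(** For A = 0 the piece is constant while its phase still advances, so only the inequality
    survives. *)
Lemma piece_length A x y : 0 <= A -> x <= y ->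
  x = y \/ (exists k, half_wave k x /\ half_wave k y) ->
  let z := A * sin x in let w := A * sin y in
  lev A (Num.max z w) - lev A (Num.min z w) <= y - x /\
  (0 < A -> lev A (Num.max z w) - lev A (Num.min z w) = y - x).
Proof.
move=> A0 xy [->|[k [hx hy]]] /=.
  by rewrite minxx maxxx !subrr.
move: A0; rewrite le_eqVlt => /predU1P[<-|A0].
  by rewrite !mul0r maxxx minxx subrr ltxx subr_ge0.
suff -> : lev A (Num.max (A * sin x) (A * sin y))
    - lev A (Num.min (A * sin x) (A * sin y)) = y - x by [].
have [[zw _ _ h]|[wz _ _ h]] := half_waveP (ltW A0) xy hx hy.
  by rewrite (min_idPl zw) (max_idPr zw) h.
by rewrite (min_idPr wz) (max_idPl wz) h.
Qed.

Lemma sin_amp_bound A x : 0 <= A -> - A <= A * sin x <= A.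
Proof.
move=> A0; rewrite -ler_norml normrM (ger0_norm A0) -[leRHS]mulr1.
by apply: ler_wpM2l => //; exact: sin_max.
Qed.

End Piece.

(** * Level sets on a graph *)

Lemma double_tan_ang (R : realType) (x y : R) : 0 <= x -> 0 < x ^+ 2 + y ^+ 2 ->
  double_tan (ang x y) = ang x (2 * y).
Proof.
move=> x0 /(polarP x0)[r [th [r0 thb -> ->]]].
by rewrite /double_tan [in LHS]ang_scale // ang_cos_sin // mulrCA ang_scale.
Qed.

Lemma lev_le (R : realType) (A a b : R) : - A <= a -> b <= A -> a < b ->
  lev A a <= lev A b.
Proof.
move=> hA bA ab.
have := @flux_ang_nondecreasing R bool (pred1 true) (fun=> A) _ a b _ ab.
rewrite /flux !big_pred1_eq; apply; [by exists true|by []].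
Qed.

Lemma sum_by_vertex (R : pzRingType) (E W : finType) (ep : E -> W)
    (g : W -> R) (F : E -> R) :
  \sum_e g (ep e) * F e = \sum_v g v * \sum_(e | ep e == v) F e.
Proof.
rewrite (partition_big ep xpredT) //=; apply: eq_bigr => v _.
by rewrite mulr_sumr; apply: eq_bigr => e /eqP ->.
Qed.

Section Core.
Variables (R : realType) (G : metric_graph R).
Hypothesis hconn : connected_graph G.

(** A closed path that uses e0 once changes side there and has no other edge on which to change
    back. *)
Lemma not_doubly_connected (side : vertex G -> bool) (e0 : edge G) :
  (forall e, e != e0 -> side (src e) = side (tgt e)) ->
  side (src e0) != side (tgt e0) -> ~ doubly_connected_edge e0.
Proof.
move=> hs hne [c [_ cc _ uc] /mapP[d dc ed]].
have [i s rs] := rot_to dc.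
have us : e0 \notin map fst s.
  by move: uc; rewrite -(rot_uniq i) -map_rot rs /= -ed => /andP[].
move: cc; rewrite -(rot_cycle i) rs /= => pd.
have key p : path (fun d1 d2 : dart G => dart_tgt d1 == dart_src d2) p (rcons s d) ->
    side (dart_tgt p) = side (dart_src d).
  elim: (s) us p => [|x s' ih] /= hx p; first by rewrite andbT => /eqP ->.
  move: hx; rewrite inE negb_or eq_sym => /andP[xe hx] /andP[/eqP -> /(ih hx) <-].
  by rewrite /dart_src /dart_tgt; case: x.2; rewrite hs.
move: hne (key _ pd); rewrite ed /dart_src /dart_tgt.
by case: d.2 => [/eqP h1 h2|/eqP h1 h2]; case: h1.
Qed.

(** * Cutting the edges into monotone pieces *)

Variables (th0 th1 A : edge G -> R) (phi : vertex G -> R) (N : nat).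
Hypothesis A_ge0 : forall e, 0 <= A e.
Hypothesis th0_ge : forall e, - (pi / 2) <= th0 e.
Hypothesis th01 : forall e, th0 e <= th1 e.
Hypothesis th1_le : forall e, th1 e <= N%:R * pi - pi / 2.
Hypothesis phi_src : forall e, A e * sin (th0 e) = phi (src e).
Hypothesis phi_tgt : forall e, A e * sin (th1 e) = phi (tgt e).
Hypothesis kir : forall v, \sum_(e | src e == v) A e * cos (th0 e)
  - \sum_(e | tgt e == v) A e * cos (th1 e) = 0.

Lemma pi_step k : k.+1%:R * pi = k%:R * pi + pi :> R.
Proof. by rewrite -natr1; ring. Qed.

(* The k-th cut point of the phase interval of e at the critical points of    *)
(* the sine.                                                                  *)
Definition cut (e : edge G) (k : nat) : R :=
  Num.min (th1 e) (Num.max (th0 e) (k%:R * pi - pi / 2)).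

Lemma cut0 e : cut e 0 = th0 e.
Proof.
rewrite /cut mul0r sub0r (max_idPl _) ?th0_ge //.
by rewrite (min_idPr _) ?th01.
Qed.

Lemma cutN e : cut e N = th1 e.
Proof. by rewrite /cut (min_idPl _) // le_max th1_le orbT. Qed.

Lemma cutS e k : cut e k = cut e k.+1 \/
  (half_wave k (cut e k) /\ half_wave k (cut e k.+1)).
Proof.
have p0 := pi_gt0 R; have := th01 e.
rewrite /cut /half_wave pi_step.
move: (th0 e) (th1 e) => x y xy.
rewrite /Num.min /Num.max; do !case: ifPn => //; rewrite -?leNgt => *; 
  first [by left; lra | right; split; apply/andP; split; lra].
Qed.

Lemma cut_le e k : cut e k <= cut e k.+1.
Proof.
have p0 := pi_gt0 R; rewrite /cut pi_step.
apply: le_min2 => //; apply: le_max2 => //; lra.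
Qed.

Notation piece := (edge G * 'I_N)%type.

Definition zval (e : edge G) (k : nat) := A e * sin (cut e k).
Definition lo (i : piece) : R := Num.min (zval i.1 i.2) (zval i.1 i.2.+1).
Definition hi (i : piece) : R := Num.max (zval i.1 i.2) (zval i.1 i.2.+1).

Lemma piece_lev i : lev (A i.1) (hi i) - lev (A i.1) (lo i)
  <= cut i.1 i.2.+1 - cut i.1 i.2.
Proof.
have [] := @piece_length R (A i.1) (cut i.1 i.2) (cut i.1 i.2.+1) (A_ge0 _) (cut_le _ _) => //.
by case: (cutS i.1 i.2) => h; [left|right; exists i.2].
Qed.

Lemma piece_const i : 0 < A i.1 -> lo i = hi i -> cut i.1 i.2 = cut i.1 i.2.+1.
Proof.
have [] := @piece_length R (A i.1) (cut i.1 i.2) (cut i.1 i.2.+1) (A_ge0 _) (cut_le _ _) => //.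
  by case: (cutS i.1 i.2) => h; [left|right; exists i.2].
move=> _ h A0; rewrite /lo /hi /zval => e; have := h A0; rewrite e subrr; lra.
Qed.

Lemma lo_hi i : lo i <= hi i.
Proof. by rewrite /lo /hi ge_min !le_max lexx. Qed.

Lemma lo_ge i : - A i.1 <= lo i.
Proof. by rewrite /lo le_min /zval !(andP (sin_amp_bound _ (A_ge0 _))).1. Qed.

Lemma hi_le i : hi i <= A i.1.
Proof. by rewrite /hi ge_max /zval !(andP (sin_amp_bound _ (A_ge0 _))).2. Qed.

Let A' (i : piece) := A i.1.

(** The one-sided values of H at t: a piece whose lowest value is t counts on the right, one whose
    highest value is t counts on the left, and a constant piece on neither. *)
Definition flux_right t := flux (fun i => lo i <= t < hi i) A' t.
Definition flux_left t := flux (fun i => lo i < t <= hi i) A' t.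

(** By [piece_jump] the jump telescopes along each edge to its two end terms. Grouped by vertex,
    these are the Kirchhoff sums of the vertices where f equals t. *)
Lemma flux_continuous t : flux_right t = flux_left t.
Proof.
apply/eqP; rewrite -subr_eq0; apply/eqP.
rewrite /flux_right /flux_left /flux [X in X - _]big_mkcond [X in _ - X]big_mkcond -sumrB.
pose b (e : edge G) k : R := (zval e k == t)%:R * (A e * cos (cut e k)).
transitivity (\sum_(i : piece) (b i.1 i.2 - b i.1 i.2.+1)).
  apply: eq_bigr => i _.
  rewrite /b -(@piece_jump R (A i.1)) ?A_ge0 ?cut_le //; last first.
    by case: (cutS i.1 i.2) => h; [left|right; exists i.2].
  rewrite -/(lo i) -/(hi i) -/(amp _ _).
  by do 2!case: ifP => _; rewrite ?mul1r ?mul0r.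
rewrite -(pair_bigA _ (fun e (k : 'I_N) => b e k - b e k.+1)) /=.
transitivity (\sum_(e : edge G) ((phi (src e) == t)%:R * (A e * cos (th0 e))
   - (phi (tgt e) == t)%:R * (A e * cos (th1 e)))).
  apply: eq_bigr => e _.
  transitivity (b e 0%N - b e N); last by rewrite /b /zval cut0 cutN phi_src phi_tgt.
  rewrite -(big_mkord xpredT (fun k => b e k - b e k.+1)).
  by rewrite -[RHS]opprB -telescope_sumr // -sumrN; apply: eq_bigr => k _; rewrite opprB.
rewrite sumrB.
have reg (ep : edge G -> vertex G) (F : edge G -> R) :
    \sum_e (phi (ep e) == t)%:R * F e =
    \sum_v (phi v == t)%:R * \sum_(e | ep e == v) F e.
  exact: sum_by_vertex ep (fun v => (phi v == t)%:R) F.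
rewrite !reg -sumrB big1 // => v _.
by rewrite -mulrBr kir mulr0.
Qed.

Definition levels : seq R := [seq lo i | i : piece] ++ [seq hi i | i : piece].

Lemma lo_level i : lo i \in levels.
Proof. by rewrite mem_cat map_f ?mem_enum. Qed.

Lemma hi_level i : hi i \in levels.
Proof. by rewrite mem_cat orbC map_f ?mem_enum. Qed.

Lemma levelP s : s \in levels -> exists i, s = lo i \/ s = hi i.
Proof.
by rewrite mem_cat => /orP[] /mapP[i _ ->]; exists i; [left|right].
Qed.

Definition cross a b (i : piece) := (lo i <= a) && (b <= hi i).

Variable c : R.
Hypothesis hc : 0 <= c <= pi / 2.

Definition weight (e : edge G) : R :=
  if `[< doubly_connected_edge e >] then calib_slope c / 2 else 1.

Lemma weight_ge e : calib_slope c / 2 <= weight e.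
Proof. by rewrite /weight; case: ifP => // _; have := calib_slope_le c; lra. Qed.

Definition alpha t := ang (flux_right t) t.

Definition clamp (i : piece) t := Num.max (lo i) (Num.min (hi i) t).

(** The weighted phase swept up to the level t, up to an additive constant. Writing the bound as a
    function of t makes the estimates of [calib_step] add up over consecutive levels. *)
Definition potential t := \sum_(i : piece) weight i.1 * lev (A i.1) (clamp i t).

(** * The strip between two consecutive levels *)

Section Consecutive.
Variables a b : R.
Hypotheses (aS : a \in levels) (bS : b \in levels) (ab : a < b).
Hypothesis hab : forall s, s \in levels -> (s <= a) || (b <= s).

Lemma flux_right_cross : flux_right a = flux (cross a b) A' a.
Proof.
apply: eq_bigl => i; rewrite /cross; congr (_ && _).
have := hab (hi_level i); case: (leP b (hi i)) => h; first by move=> _; rewrite (lt_le_trans ab h).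
by rewrite orbF => h'; rewrite ltNge h'.
Qed.

Lemma flux_left_cross : flux_left b = flux (cross a b) A' b.
Proof.
apply: eq_bigl => i; rewrite /cross; congr (_ && _).
have := hab (lo_level i); case: (leP (lo i) a) => h; first by move=> _; rewrite (le_lt_trans h ab).
by rewrite /= => h'; rewrite ltNge h'.
Qed.

Let side (s : R) : bool := s <= a.

(** No level lies strictly between a and b, so each end value of a piece is either <= a or >= b, and
    crossing means that the two ends differ. This turns crossings into parities, which telescope
    along an edge in [edge_side]. *)
Lemma cross_side (i : piece) :
  cross a b i = side (zval i.1 i.2) (+) side (zval i.1 i.2.+1).
Proof.
have hz : (zval i.1 i.2 <= a) || (b <= zval i.1 i.2).
  have := hab (lo_level i); have := hab (hi_level i); rewrite /lo /hi.
  by case: (leP (zval i.1 i.2) (zval i.1 i.2.+1)).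
have hw : (zval i.1 i.2.+1 <= a) || (b <= zval i.1 i.2.+1).
  have := hab (lo_level i); have := hab (hi_level i); rewrite /lo /hi.
  by case: (leP (zval i.1 i.2) (zval i.1 i.2.+1)).
have sep s : (s <= a) || (b <= s) -> (b <= s) = ~~ (s <= a).
  case: (leP s a) => [sa _|_ //]; apply/negbTE; rewrite -ltNge.
  exact: le_lt_trans sa ab.
rewrite /cross /lo /hi ge_min le_max (sep _ hz) (sep _ hw) /side.
by case: (_ <= a); case: (_ <= a).
Qed.

Lemma edge_side e : side (phi (src e)) (+) side (phi (tgt e)) =
  \big[addb/false]_(k < N) cross a b (e, k).
Proof.
under eq_bigr do rewrite cross_side /=.
rewrite (addb_telescope N (fun k => side (zval e k))).
by rewrite /zval cut0 cutN phi_src phi_tgt.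
Qed.

(** Without a crossing, [side] is constant along edges, hence by connectedness on all vertices and
    all cut values; but a and b are such values on different sides. *)
Lemma cross_exists : exists i, cross a b i.
Proof.
apply: contrapT => no; have {}no i : cross a b i = false.
  by apply/negP => ci; apply: no; exists i.
have hedge e : side (phi (src e)) = side (phi (tgt e)).
  by apply/eqP; rewrite -[_ == _]negbK -negb_add /= edge_side big1.
have hv u v : side (phi u) = side (phi v).
  suff cl : fingraph.closed (@Defs.adjacent R G) [pred w | side (phi w)].
    by have := closed_connect cl (hconn u v); rewrite !inE.
  move=> x y /existsP[e /orP[] /andP[/eqP <- /eqP <-]]; rewrite !inE hedge //.
have hz e k : (k <= N)%N -> side (zval e k) = side (phi (src e)).
  elim: k => [|k ih] kN; first by rewrite /zval cut0 phi_src.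
  rewrite -(ih (ltnW kN)); have := cross_side (e, Ordinal kN).
  by rewrite no /= => /esym/negbT; rewrite negb_add => /eqP.
have hl s : s \in levels -> exists v, side s = side (phi v).
  move=> /levelP[i hs]; exists (src i.1).
  suff : s = zval i.1 i.2 \/ s = zval i.1 i.2.+1 by case=> ->; rewrite hz // ltnW.
  by case: hs => ->; rewrite /lo /hi /Num.min /Num.max; case: ifP; auto.
have [va ha] := hl _ aS; have [vb hb] := hl _ bS.
have : side a = side b by rewrite ha hb; exact: hv.
by rewrite /side lexx leNgt ab.
Qed.

(** By parity, the edge of i is the only one whose endpoints lie on different sides of the strip. *)
Lemma single_cross_bridge i : cross a b i -> (forall j, cross a b j -> j = i) ->
  ~ doubly_connected_edge i.1.
Proof.
move=> ci hi1; apply: (@not_doubly_connected (fun v => side (phi v))) => [e ei|].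
  apply/eqP; rewrite -[_ == _]negbK -negb_add /= edge_side big1 // => k _.
  by apply/negbTE; apply: contra ei => /hi1 <-.
rewrite -negb_add negbK edge_side (bigD1 i.2) //= -surjective_pairing ci big1 //.
move=> k ki; apply/negbTE; apply: contra ki => /hi1 <- //.
Qed.

Lemma cross_amp i : cross a b i -> - A i.1 <= a /\ b <= A i.1.
Proof.
move=> /andP[h1 h2]; split; first exact: le_trans (lo_ge i) h1.
exact: le_trans h2 (hi_le i).
Qed.

(** Every summand sqrt (A ^ 2 - t ^ 2) grows as t < 0 approaches 0. Since H vanishes at both extreme
    values of f, this and its mirror image force f to change sign. *)
Lemma flux_increasing_neg : b <= 0 -> flux_right a < flux_right b.
Proof.
move=> b0; rewrite flux_right_cross [ltRHS]flux_continuous flux_left_cross.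
have [i ci] := cross_exists; apply: ltr_sum; first by apply/hasP; exists i; rewrite ?mem_index_enum.
move: ab => ab' j /cross_amp[h1 h2]; rewrite ltr_sqrt /A' ?ltrD2l ?ltrN2.
  by have : 0 < (- b - a) * (b - a) by [apply: mulr_gt0; lra]; nra.
by have : 0 < (A j.1 - b) * (A j.1 + b) by [apply: mulr_gt0; lra]; nra.
Qed.

Lemma flux_decreasing_pos : 0 <= a -> flux_right b < flux_right a.
Proof.
move=> a0; rewrite flux_right_cross [ltLHS]flux_continuous flux_left_cross.
have [i ci] := cross_exists; apply: ltr_sum; first by apply/hasP; exists i; rewrite ?mem_index_enum.
move: ab => ab' j /cross_amp[h1 h2]; rewrite ltr_sqrt /A' ?ltrD2l ?ltrN2.
  by have : 0 < (b + a) * (b - a) by [apply: mulr_gt0; lra]; nra.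
by have : 0 < (A j.1 - a) * (A j.1 + a) by [apply: mulr_gt0; lra]; nra.
Qed.

Lemma potential_increment : potential b - potential a =
  \sum_(i | cross a b i) weight i.1 * (lev (A i.1) b - lev (A i.1) a).
Proof.
rewrite /potential -sumrB [RHS]big_mkcond; apply: eq_bigr => i _.
rewrite -mulrBr /clamp; have := lo_hi i; case: ifP => [/andP[h1 h2] h|].
  by rewrite (min_idPr h2) (max_idPr (ltW (le_lt_trans h1 ab)))
    (min_idPr (le_trans (ltW ab) h2)) (max_idPr h1).
move=> /negbT; rewrite negb_and -!ltNge => h hlo.
suff -> : Num.max (lo i) (Num.min (hi i) b) = Num.max (lo i) (Num.min (hi i) a).
  by rewrite subrr mulr0.
case/orP: h => h.
  have := hab (lo_level i); rewrite leNgt h /= => h'.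
  by rewrite !(max_idPl _) // ge_min ?h' ?(ltW h) orbT.
have := hab (hi_level i); rewrite [b <= _]leNgt h orbF => h'.
by rewrite !(min_idPl _) // ltW.
Qed.

Lemma calib_step :
  calib c (alpha b) - calib c (alpha a) <= potential b - potential a.
Proof.
have [i ci] := cross_exists.
have ex : exists i, cross a b i by exists i.
have ca j : cross a b j -> - A' j <= a /\ b <= A' j := @cross_amp j.
have pos k t : 0 < k -> a <= t <= b -> 0 < flux (cross a b) A' t ^+ 2 + (k * t) ^+ 2.
  by move=> k0; apply: flux_pos => //; exact: ab.
have pa : 0 < flux (cross a b) A' a ^+ 2 + a ^+ 2.
  by have := pos 1 a ltr01; rewrite mul1r lexx ltW //; apply.
have pb : 0 < flux (cross a b) A' b ^+ 2 + b ^+ 2.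
  by have := pos 1 b ltr01; rewrite mul1r lexx ltW //; apply.
have aE : alpha a = ang (flux (cross a b) A' a) a by rewrite /alpha flux_right_cross.
have bE : alpha b = ang (flux (cross a b) A' b) b.
  by rewrite /alpha flux_continuous flux_left_cross.
have f0 := flux_ge0 (cross a b) A'.
have /andP[a1 a2] := ang_bound (f0 a) pa.
have /andP[b1 b2] := ang_bound (f0 b) pb.
have ab1 := flux_ang_nondecreasing ex ca ab.
have [h1 h2] := calib_increment hc a1 ab1 b2.
rewrite aE bE potential_increment.
(* With two crossings the [double_tan] bound applies, and its factor [calib_slope c / 2] is at most
   the weight of any edge. With a single crossing the identity bound applies, and the edge is a
   bridge of weight 1. *)
have [/existsP[j /andP[cj ji]]|no] := boolP [exists j, cross a b j && (j != i)].
  apply: (le_trans h2); rewrite !double_tan_ang //.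
  have hd : ang (flux (cross a b) A' b) (2 * b) - ang (flux (cross a b) A' a) (2 * a)
      <= \sum_(k | cross a b k) (lev (A k.1) b - lev (A k.1) a) / 2.
    exact: flux_double_ang_increment cj ci ji ca ab.
  have s0 := calib_slope_ge c.
  apply: (@le_trans _ _ (calib_slope c *
    \sum_(k | cross a b k) (lev (A k.1) b - lev (A k.1) a) / 2)).
    by apply: ler_wpM2l => //; lra.
  rewrite mulr_sumr; apply: ler_sum => k ck.
  have [k1 k2] := ca _ ck; have l0 : 0 <= lev (A k.1) b - lev (A k.1) a.
    by rewrite subr_ge0; exact: lev_le k1 k2 ab.
  have w0 : 0 <= weight k.1 - calib_slope c / 2 by rewrite subr_ge0 weight_ge.
  have := mulr_ge0 w0 l0; lra.
have un j : cross a b j -> j = i.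
  move=> cj; apply/eqP; rewrite -[_ == _]negbK; apply: contra no => ji.
  by apply/existsP; exists j; rewrite cj.
have eqc : cross a b =1 pred1 i.
  move=> j; apply/idP/eqP => [/un //|->]; exact: ci.
apply: (le_trans h1); rewrite /flux !(big_pred1 i) // /weight asboolF ?mul1r //.
exact: single_cross_bridge ci un.
Qed.

End Consecutive.

Lemma calib_bound : (exists e, 0 < A e /\ th0 e < th1 e) ->
  2 * (c + calib_slope c * (pi / 2 - double_tan c))
  <= \sum_e weight e * (th1 e - th0 e).
Proof.
move=> [e [Ae the]].
(* If all pieces were constant, all cut points of e would coincide, against [th0 e < th1 e]. *)
have [i0 i0lt] : exists i : piece, lo i < hi i.
  apply: contrapT => no.
  suff h k : (k <= N)%N -> cut e k = th0 e.
    by move: the; rewrite -(h N) // cutN ltxx.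
  elim: k => [|k ih] kN; first exact: cut0.
  rewrite -(ih (ltnW kN)); apply/esym.
  apply: (@piece_const (e, Ordinal kN) Ae); apply/eqP; rewrite eq_le lo_hi /= leNgt.
  by apply/negP => ?; apply: no; exists (e, Ordinal kN).
have [m [mS mlow mhd]] : exists m, [/\ m \in levels, (forall i, m <= lo i) & m <= lo i0].
  have [im _ h] := @Order.TotalTheory.arg_minP _ _ _ i0 xpredT lo isT.
  exists (lo im); split => [|i|]; [exact: lo_level|exact: h|exact: h].
have [M [MS Mup Mhd]] : exists M, [/\ M \in levels, (forall i, hi i <= M) & hi i0 <= M].
  have [iM _ h] := @Order.TotalTheory.arg_maxP _ _ _ i0 xpredT hi isT.
  exists (hi iM); split => [|i|]; [exact: hi_level|exact: h|exact: h].
have mM : m < M by lra.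
have FM : flux_right M = 0.
  rewrite /flux_right /flux big_pred0 // => i.
  by rewrite [M < _]ltNge Mup andbF.
have Fm : flux_right m = 0.
  rewrite flux_continuous /flux_left /flux big_pred0 // => i.
  by rewrite ltNge mlow.
(* If M <= 0, the flux would increase strictly from m to M, yet it vanishes at both. *)
have M0 : 0 < M.
  rewrite ltNge; apply/negP => M0.
  suff : flux_right m < flux_right M by rewrite FM Fm ltxx.
  move: M0; apply: (@consecutive_ind R levels
    (fun a b => b <= 0 -> flux_right a < flux_right b) _ _ m M mS MS mM).
  - by move=> a b aS bS ab h; exact: flux_increasing_neg.
  - move=> a b d ab bd h1 h2 d0; apply: lt_trans (h2 d0); apply: h1; lra.
have m0 : m < 0.
  rewrite ltNge; apply/negP => m0.
  suff : flux_right M < flux_right m by rewrite FM Fm ltxx.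
  move: m0; apply: (@consecutive_ind R levels
    (fun a b => 0 <= a -> flux_right b < flux_right a) _ _ m M mS MS mM).
  - by move=> a b aS bS ab h; exact: flux_decreasing_pos.
  - move=> a b d ab bd h1 h2 a0; apply: lt_trans (h1 a0); apply: h2; lra.
have : calib c (alpha M) - calib c (alpha m) <= potential M - potential m.
  apply: (@consecutive_ind R levels (fun a b =>
    calib c (alpha b) - calib c (alpha a) <= potential b - potential a) _ _ m M mS MS mM).
  - by move=> a b aS bS ab h; exact: calib_step.
  - by move=> a b d _ _ h1 h2; lra.
have -> : alpha M = pi / 2 by rewrite /alpha FM ang_pihalf.
have -> : alpha m = - (pi / 2).
  by rewrite /alpha Fm -[m]opprK ang_opp ang_pihalf // oppr_gt0.
rewrite calib_pihalf // calib_Npihalf // => h.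
have {}h : 2 * (c + calib_slope c * (pi / 2 - double_tan c)) <= potential M - potential m.
  lra.
apply: (le_trans h); rewrite /potential -sumrB.
(* All pieces range within [m, M], so the clamps are the ends of the pieces; each piece contributes
   at most its phase length, and these telescope along the edge. *)
apply: (@le_trans _ _ (\sum_(i : piece) weight i.1 * (cut i.1 i.2.+1 - cut i.1 i.2))).
  apply: ler_sum => i _; rewrite -mulrBr; apply: ler_wpM2l.
    by have := weight_ge i.1; have := calib_slope_ge c; lra.
  rewrite /clamp (min_idPl (Mup i)) (max_idPr (lo_hi i)).
  rewrite (min_idPr (le_trans (mlow i) (lo_hi i))) (max_idPl (mlow i)).
  exact: piece_lev.
rewrite -(pair_bigA _ (fun e (k : 'I_N) => weight e * (cut e k.+1 - cut e k))) /=.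
apply: ler_sum => e' _; rewrite -mulr_sumr.
rewrite -(big_mkord xpredT (fun k => cut e' k.+1 - cut e' k)) telescope_sumr //.
by rewrite cutN cut0.
Qed.

End Core.

(** * Eigenfunctions on an edge *)

Section OneSided.
Variable R : realType.
Implicit Types (l x : R) (f g df dg : R -> R).

Lemma has_derivative_on_is_derive l f df x : has_derivative_on l f df ->
  0 < x < l -> is_derive x 1 f (df x).
Proof.
move=> hf /andP[x0 xl].
have hx : 0 <= x <= l by rewrite !ltW.
apply/is_derive1_caratheodory.
pose q z := if z == x then df x else (f z - f x) / (z - x).
exists q; split; last by rewrite /q eqxx.
- move=> z; rewrite /q; case: eqP => [->|/eqP zx]; first by rewrite !subrr mulr0.
  by rewrite divfK // subr_eq0.
- apply/continuous_withinNx; rewrite /q eqxx.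
  move=> U hU.
  have h : \forall z \near x, z != x -> `[0, l]%classic z ->
      U ((f z - f x) / (z - x)) by exact: (hf x hx U hU).
  have hn : \forall z \near x, z \in `]0, l[.
    by apply: near_in_itvoo; rewrite in_itv /= x0.
  apply: filterS2 hn h => z; rewrite in_itv /= => /andP[z0 zl] hz zx.
  rewrite (negbTE zx); apply: hz => //; by rewrite /= in_itv /= !ltW.
Qed.

Lemma has_derivative_on_continuous l f df : has_derivative_on l f df ->
  {within `[0, l], continuous f}.
Proof.
move=> hf; apply/subspace_continuousP => x; rewrite /= in_itv /= => hx.
pose F z := f x + (f z - f x) / (z - x) * (z - x).
have fE : f = F.
  apply/funext => z; rewrite /F; have [->|zx] := eqVneq z x.
    by rewrite !subrr mulr0 addr0.
  by rewrite divfK ?subr_eq0 // addrC subrK.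
have hF : F z @[z --> within `[0, l] x^'] --> f x + df x * (x - x).
  apply: cvgD; first exact: cvg_cst.
  apply: cvgM; first exact: hf.
  apply: cvgB; last exact: cvg_cst.
  move=> U hU; suff : \forall z \near x, z != x -> `[0, l]%classic z -> U z by [].
  by apply: filterS hU => z.
have h : f z @[z --> within `[0, l] x^'] --> f x.
  by move: hF; rewrite subrr mulr0 addr0 -fE.
move=> U nU.
have h' : \forall z \near x, z != x -> `[0, l]%classic z -> U (f z) by exact: (h U nU).
suff : \forall z \near x, `[0, l]%classic z -> U (f z) by [].
apply: filterS h' => z hz Az; have [->|zx] := eqVneq z x; last exact: hz.
exact: nbhs_singleton.
Qed.

Lemma within_continuousM l f g : {within `[0, l], continuous f} ->
  {within `[0, l], continuous g} -> {within `[0, l], continuous (fun x => f x * g x)}.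
Proof. by move=> cf cg x; apply: continuousM; [exact: cf|exact: cg]. Qed.

Lemma within_continuousW l x f : x <= l -> {within `[0, l], continuous f} ->
  {within `[0, x], continuous f}.
Proof.
move=> xl; apply: continuous_subspaceW => y /=; rewrite !in_itv /= => /andP[-> yx].
exact: le_trans yx xl.
Qed.

Lemma derive_eq0_const l f x : {within `[0, l], continuous f} ->
  (forall y, 0 < y < l -> is_derive y 1 f 0) -> 0 <= x <= l -> f x = f 0.
Proof.
move=> cf df0 /andP[x0 xl]; have cx := within_continuousW xl cf.
have dx y : 0 < y < x -> is_derive y 1 f 0.
  by move=> /andP[y0 yx]; apply: df0; rewrite y0 (lt_le_trans yx).
apply/eqP; rewrite eq_le; apply/andP; split; last first.
  exact: (@derive_ge0_le R f (fun=> 0) 0 x).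
rewrite -lerN2; apply: (@derive_ge0_le R (fun y => - f y) (fun=> 0) 0 x) => //.
- by move=> y; apply: continuousN; exact: cx.
- by move=> y /dx h; rewrite -[0]oppr0; exact: is_deriveN.
Qed.

(** Points with X < 0 are reached by adding pi, so that phases never start below - pi / 2, the
    position of the zeroth cut. *)
Lemma polar_full (X Y : R) : exists A t, [/\ 0 <= A, - (pi / 2) <= t,
  X = A * cos t & Y = A * sin t].
Proof.
have p0 := pi_gt0 R.
have [X0|X0] := leP 0 X.
  have [s0|s0] := ltP 0 (X ^+ 2 + Y ^+ 2).
    have [r [t [r0 /andP[t1 _] hX hY]]] := polarP X0 s0.
    by exists r, t; split => //; exact: ltW.
  have /eqP : X ^+ 2 + Y ^+ 2 = 0.
    by apply/eqP; rewrite eq_le s0 addr_ge0 ?sqr_ge0.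
  rewrite paddr_eq0 ?sqr_ge0 // !sqrf_eq0 => /andP[/eqP -> /eqP ->].
  by exists 0, 0; rewrite !mul0r; split => //; lra.
have s0 : 0 < (- X) ^+ 2 + (- Y) ^+ 2 by rewrite ltr_pwDl ?sqr_ge0 // exprn_gt0 // oppr_gt0.
have nX : 0 <= - X by lra.
have [r [t [r0 /andP[t1 _] hX hY]]] := polarP nX s0.
exists r, (t + pi); split; [exact: ltW|lra|rewrite cosDpi|rewrite sinDpi]; lra.
Qed.

(** [P] and [Q] are w f and f' rotated back by the angle w x. The equation makes them constant, and
    A, t are the polar coordinates of (Q, P) / w. *)
Lemma helmholtz_solution l w f df : 0 < w -> 0 < l ->
  has_derivative_on l f df ->
  has_derivative_on l df (fun x => - (w ^+ 2 * f x)) ->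
  exists A t, [/\ 0 <= A, - (pi / 2) <= t & forall x, 0 <= x <= l ->
    f x = A * sin (t + w * x) /\ df x = w * (A * cos (t + w * x))].
Proof.
move=> w0 l0 hf hdf.
have cf := has_derivative_on_continuous hf.
have cdf := has_derivative_on_continuous hdf.
pose s x := sin (w * x); pose k x := cos (w * x).
have ds x : is_derive x 1 s (k x * w).
  have h := @is_deriveZ R _ _ _ w x 1 _ (is_derive_id x 1).
  have := @is_derive1_comp R sin _ x _ _ (is_derive_sin _) h.
  by move=> h'; apply: (is_derive_eq h'); rewrite /GRing.scale /= mulr1.
have dk x : is_derive x 1 k (- s x * w).
  have h := @is_deriveZ R _ _ _ w x 1 _ (is_derive_id x 1).
  have := @is_derive1_comp R cos _ x _ _ (is_derive_cos _) h.
  by move=> h'; apply: (is_derive_eq h'); rewrite /GRing.scale /= mulr1.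
have cs : {within `[0, l], continuous s}.
  apply: derivable_within_continuous => x _; exact: ex_derive.
have ck : {within `[0, l], continuous k}.
  apply: derivable_within_continuous => x _; exact: ex_derive.
pose P x := w * (f x * k x) - df x * s x.
pose Q x := w * (f x * s x) + df x * k x.
have P0 x : 0 <= x <= l -> P x = P 0.
  apply: derive_eq0_const => [|y hy].
    apply: (@within_continuousB _ _ _ _ (fun x => w * (f x * k x))
      (fun x => df x * s x)); last exact: within_continuousM.
    apply: (@within_continuousM l (fun=> w)); last exact: within_continuousM.
    by move=> y; exact: cst_continuous.
  have df1 := has_derivative_on_is_derive hf hy.
  have df2 := has_derivative_on_is_derive hdf hy.
  have h := is_deriveB (@is_deriveZ R _ _ _ w y 1 _ (is_deriveM df1 (dk y)))
              (is_deriveM df2 (ds y)).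
  apply: (is_derive_eq h); rewrite /GRing.scale /=; ring.
have Q0 x : 0 <= x <= l -> Q x = Q 0.
  apply: derive_eq0_const => [|y hy].
    apply: (@within_continuousD _ _ _ _ (fun x => w * (f x * s x))
      (fun x => df x * k x)); last exact: within_continuousM.
    apply: (@within_continuousM l (fun=> w)); last exact: within_continuousM.
    by move=> y; exact: cst_continuous.
  have df1 := has_derivative_on_is_derive hf hy.
  have df2 := has_derivative_on_is_derive hdf hy.
  have h := is_deriveD (@is_deriveZ R _ _ _ w y 1 _ (is_deriveM df1 (ds y)))
              (is_deriveM df2 (dk y)).
  apply: (is_derive_eq h); rewrite /GRing.scale /=; ring.
have [A [t [A0 t0 hQ hP]]] := polar_full (Q 0 / w) (P 0 / w).
exists A, t; split => // x hx.
have eP : P x = w * (A * sin t) by rewrite P0 // -hP mulrC divfK ?gt_eqF.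
have eQ : Q x = w * (A * cos t) by rewrite Q0 // -hQ mulrC divfK ?gt_eqF.
have cs1 : k x ^+ 2 + s x ^+ 2 = 1 by exact: cos2Dsin2.
rewrite sinD cosD -/(s x) -/(k x); split.
  apply: (mulfI (lt0r_neq0 w0)).
  transitivity (w * f x * (k x ^+ 2 + s x ^+ 2)); first by rewrite cs1 mulr1.
  transitivity (P x * k x + Q x * s x); first by rewrite /P /Q; ring.
  by rewrite eP eQ; ring.
transitivity (df x * (k x ^+ 2 + s x ^+ 2)); first by rewrite cs1 mulr1.
transitivity (Q x * k x - P x * s x); first by rewrite /P /Q; ring.
by rewrite eP eQ; ring.
Qed.

(** The derivative of f f' is f' ^ 2 - lam f ^ 2 >= 0. Equal end values make f f' constant, which
    forces f' = 0 in the interior. *)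
Lemma nonpositive_energy l lam f df : 0 < l -> lam <= 0 ->
  has_derivative_on l f df ->
  has_derivative_on l df (fun x => - (lam * f x)) ->
  f 0 * df 0 <= f l * df l /\
  (f 0 * df 0 = f l * df l -> forall x, 0 <= x <= l -> f x = f 0).
Proof.
move=> l0 lam0 hf hdf.
have cf := has_derivative_on_continuous hf.
have cdf := has_derivative_on_continuous hdf.
pose E x := f x * df x.
have cE : {within `[0, l], continuous E} by exact: within_continuousM.
have dE x : 0 < x < l -> is_derive x 1 E (df x ^+ 2 - lam * f x ^+ 2).
  move=> hx; have h := is_deriveM (has_derivative_on_is_derive hf hx)
    (has_derivative_on_is_derive hdf hx).
  apply: (is_derive_eq h); rewrite /GRing.scale /=; ring.
have dE0 x : 0 <= df x ^+ 2 - lam * f x ^+ 2.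
  by rewrite addr_ge0 ?sqr_ge0 // oppr_ge0 mulr_le0_ge0 ?sqr_ge0.
have Emono x y : 0 <= x -> x <= y -> y <= l -> E x <= E y.
  move=> x0 xy yl; apply: (@derive_ge0_le R E (fun x => df x ^+ 2 - lam * f x ^+ 2)) => //.
    apply: continuous_subspaceW cE => z /=; rewrite !in_itv /= => /andP[z0 zl].
    by rewrite (le_trans x0 z0) (le_trans zl yl).
  by move=> z /andP[xz zy]; apply: dE; rewrite (le_lt_trans x0 xz) (lt_le_trans zy yl).
split; first by apply: Emono => //; exact: ltW.
move=> eE x hx.
have Ec y : 0 <= y <= l -> E y = E 0.
  move=> /andP[y0 yl]; apply/eqP; rewrite eq_le [X in _ && X]Emono //.
  by rewrite andbT [leRHS]eE; exact: Emono.
apply: (derive_eq0_const cf _ hx) => y hy.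
have h0 : is_derive y 1 E 0.
  apply: near_eq_is_derive (is_derive_cst (E 0) y 1).
  have hn : \forall z \near y, z \in `]0, l[ by apply: near_in_itvoo; rewrite in_itv.
  near=> z; rewrite Ec //.
  have : z \in `]0, l[ by near: z.
  by rewrite in_itv /= => /andP[z0 zl]; rewrite !ltW.
have hE := dE y hy.
have d0 : df y ^+ 2 - lam * f y ^+ 2 = 0.
  by rewrite -(@derive_val _ _ _ _ _ _ _ hE) (@derive_val _ _ _ _ _ _ _ h0).
have : df y ^+ 2 == 0.
  have : 0 <= - (lam * f y ^+ 2) by rewrite oppr_ge0 mulr_le0_ge0 ?sqr_ge0.
  by have := sqr_ge0 (df y); rewrite eq_le; lra.
rewrite sqrf_eq0 => /eqP <-; exact: has_derivative_on_is_derive hy.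
Unshelve. all: by end_near. Qed.

End OneSided.

(** * Eigenfunctions on a graph and on the dumbbell *)

Section Eigenfunction.
Variables (R : realType) (G : metric_graph R).
Hypothesis hconn : connected_graph G.

(** Integration by parts over the graph: the increments of f f' over the edges are nonnegative, and
    their sum regroups into vertex values times Kirchhoff sums, which is 0. So f is constant on each
    edge, and connectedness does the rest. *)
Lemma eigenfunction_const (lam : R) (f : edge G -> R -> R) : lam <= 0 ->
  in_eigenspace lam f -> exists c, forall e x, 0 <= x <= len e -> f e x = c.
Proof.
move=> lam0 [df [hf hdf [phi hphi] kir]].
have en e := nonpositive_energy (len_gt0 e) lam0 (hf e) (hdf e).
pose D e := f e (len e) * df e (len e) - f e 0 * df e 0.
have D0 e : true -> 0 <= D e by rewrite /D subr_ge0; case: (en e).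
have sD : \sum_e D e = 0.
  rewrite /D sumrB.
  under eq_bigr do rewrite (hphi _).2.
  under [X in _ - X]eq_bigr do rewrite (hphi _).1.
  rewrite (sum_by_vertex (@tgt R G) phi (fun e => df e (len e))).
  rewrite (sum_by_vertex (@src R G) phi (fun e => df e 0)) -sumrB big1 // => v _.
  by rewrite -mulrBr -[X in _ * X]opprB -sumrN kir oppr0 mulr0.
have fc e x : 0 <= x <= len e -> f e x = phi (src e).
  move=> hx; rewrite -(hphi e).1; apply: (en e).2 => //.
  have := @psumr_eq0P _ _ _ D D0 sD e isT; rewrite /D => /eqP.
  by rewrite subr_eq0 => /eqP.
have hedge e : phi (src e) = phi (tgt e).
  by rewrite -(hphi e).2 fc // lexx ltW // len_gt0.
have hv u v : phi u = phi v.
  suff cl : fingraph.closed (@Defs.adjacent R G) [pred w | phi w == phi v].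
    by apply/eqP; have := closed_connect cl (hconn u v); rewrite !inE eqxx.
  by move=> x y /existsP[e /orP[] /andP[/eqP <- /eqP <-]]; rewrite !inE hedge.
have [[e0]|no] := pselect (exists e0 : edge G, True).
  by move=> _; exists (phi (src e0)) => e x /fc ->.
by exists 0 => e; case: no; exists e.
Qed.

Lemma eigenfunction_length_bound (w : R) (f : edge G -> R -> R) (c : R) : 0 < w ->
  in_eigenspace (w ^+ 2) f ->
  (exists e x, 0 <= x <= len e /\ f e x != 0) -> 0 <= c <= pi / 2 ->
  2 * (c + calib_slope c * (pi / 2 - double_tan c))
  <= w * (total_length G - doubly_connected_length G
          + calib_slope c / 2 * doubly_connected_length G).
Proof.
move=> w0 [df [hf hdf [phi hphi] kir]] [e1 [x1 [hx1 fx1]]] hc.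
have p0 := pi_gt0 R.
have /choice[At hAt] e : exists At : R * R, [/\ 0 <= At.1, - (pi / 2) <= At.2 &
    forall x, 0 <= x <= len e -> f e x = At.1 * sin (At.2 + w * x) /\
      df e x = w * (At.1 * cos (At.2 + w * x))].
  have [A [t [A0 t0 h]]] := helmholtz_solution w0 (len_gt0 e) (hf e) (hdf e).
  by exists (A, t).
pose A e := (At e).1; pose th0 e := (At e).2; pose th1 e := th0 e + w * len e.
have A0 e : 0 <= A e by case: (hAt e).
have t0 e : - (pi / 2) <= th0 e by case: (hAt e).
have hA e x : 0 <= x <= len e -> f e x = A e * sin (th0 e + w * x) /\
   df e x = w * (A e * cos (th0 e + w * x)) by case: (hAt e) => _ _; apply.
have l0 (e : edge G) : 0 <= (0 : R) <= len e by rewrite lexx ltW // len_gt0.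
have ll (e : edge G) : 0 <= len e <= len e by rewrite lexx ltW // len_gt0.
(* One number of half waves that covers the phase intervals of all edges. *)
have [N hN] : exists N : nat, forall e, th1 e <= N%:R * pi - pi / 2.
  have ex e : exists n : nat, th1 e <= n%:R * pi - pi / 2.
    exists (Num.bound (`|th1 e + pi / 2| / pi)).
    have := archi_boundP (divr_ge0 (normr_ge0 (th1 e + pi / 2)) (ltW p0)).
    rewrite ltr_pdivrMr // => h; have := ler_norm (th1 e + pi / 2); lra.
  have [n hn] := choice ex; exists (\max_e n e)%N => e; apply: (le_trans (hn e)).
  rewrite lerB // ler_pM2r // ler_nat; exact: (leq_bigmax e).
have th01 e : th0 e < th1 e by rewrite /th1 ltrDl mulr_gt0 // len_gt0.
have wl := @calib_bound R G hconn th0 th1 A phi N A0 t0 (fun e => ltW (th01 e)) hN.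
have {}wl h1 h2 h3 := wl h1 h2 h3 c hc; apply: (le_trans (wl _ _ _ _)).
- by move=> e; rewrite -(hphi e).1 (hA e 0 (l0 e)).1 mulr0 addr0.
- by move=> e; rewrite -(hphi e).2 (hA e _ (ll e)).1.
- move=> v; apply: (mulfI (lt0r_neq0 w0)); rewrite mulr0 -[RHS](kir v) mulrBr.
  rewrite sumrN !mulr_sumr; congr (_ - _); apply: eq_bigr => e _.
    by rewrite (hA e 0 (l0 e)).2 mulr0 addr0.
  by rewrite (hA e _ (ll e)).2.
- exists e1; split => //; rewrite lt_def A0 andbT.
  by apply: contra fx1 => /eqP Ae; rewrite (hA _ _ hx1).1 Ae mul0r.
rewrite /total_length /doubly_connected_length [X in _ - X]big_mkcond.
rewrite [X in _ / _ * X]big_mkcond /= -sumrB mulr_sumr -big_split mulr_sumr /=.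
apply: ler_sum => e _; rewrite /weight /th1 [th0 e + _]addrC addrK.
by case: ifP => _; rewrite ?mulr0 ?subr0 ?subrr ?addr0 ?add0r ?mul1r // mulrCA.
Qed.

End Eigenfunction.

Lemma sum_sig (M : nmodType) (I : finType) (P : pred I) (F : I -> M) :
  \sum_(e : {i | P i}) F (val e) = \sum_(i | P i) F i.
Proof.
rewrite [RHS](reindex_omap (val : {i | P i} -> I) insub); last first.
  by move=> i Pi; rewrite insubT.
by apply: eq_bigl => -[i Pi] /=; rewrite insubT /= eqxx Pi.
Qed.

(** * The odd eigenfunction of the dumbbell *)

Section DumbbellEigenvalue.
Variable R : realType.

(** The equation is the matching condition at a vertex of the dumbbell, with a half the handle and b
    half a loop. The intermediate value theorem is applied between 0, where the difference of the
    sides is 1, and the frequency at which the larger angle reaches pi / 2, where the product of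
    cosines vanishes. *)
Lemma dumbbell_frequency (a b : R) : 0 <= a -> 0 <= b -> 0 < a + b ->
  exists w, [/\ 0 < w, w * a <= pi / 2, w * b <= pi / 2 &
    cos (w * a) * cos (w * b) = 2 * (sin (w * a) * sin (w * b))].
Proof.
move=> a0 b0 ab; have p0 := pi_gt0 R.
pose m := Num.max a b.
have m0 : 0 < m by rewrite /m; case: (leP a b) => ?; lra.
have [am bm] : a <= m /\ b <= m by rewrite /m !le_max !lexx orbT.
pose g w := cos (w * a) * cos (w * b) - 2 * (sin (w * a) * sin (w * b)).
have cM (z : R) : continuous (fun w : R => w * z).
  by move=> x; apply: continuousM => //; exact: cst_continuous.
have cg : continuous g.
  have cc (z : R) : continuous (fun w : R => cos (w * z)).
    by move=> x; apply: (continuous_comp (cM z x)); exact: continuous_cos.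
  have cs (z : R) : continuous (fun w : R => sin (w * z)).
    by move=> x; apply: (continuous_comp (cM z x)); exact: continuous_sin.
  move=> x; have h1 := continuousM (cc a x) (cc b x).
  have h2 := continuousM (@cst_continuous R R 2 x) (continuousM (cs a x) (cs b x)).
  exact: continuousB h1 h2.
pose W := pi / 2 / m.
have W0 : 0 < W by rewrite /W !divr_gt0.
have Wle z : 0 <= z -> z <= m -> 0 <= W * z <= pi / 2.
  move=> z0 zm; rewrite mulr_ge0 ?(ltW W0) //=.
  by rewrite /W mulrAC ler_pdivrMr // ler_pM2l // divr_gt0.
have Wm : W * m = pi / 2 by rewrite /W divfK // gt_eqF.
have g0 : g 0 = 1 by rewrite /g !mul0r cos0 sin0; ring.
have gW : g W <= 0.
  have sge z : 0 <= z -> z <= m -> 0 <= sin (W * z).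
    by move=> z0 zm; apply: sin_ge0_pi; have := Wle z z0 zm; lra.
  have : 0 <= sin (W * a) * sin (W * b) by rewrite mulr_ge0 ?sge.
  have : cos (W * a) * cos (W * b) = 0; last by rewrite /g; lra.
  move: Wm; rewrite /m; case: (leP a b) => _ ->; rewrite cos_pihalf ?mulr0 ?mul0r //.
have [|w] := @IVT R g 0 W 0 (ltW W0) (continuous_subspaceT cg).
  by rewrite g0 ge_min gW orbT /= le_max ler01.
rewrite in_itv /= => /andP[w0 wW] gw; exists w.
have wn : 0 < w.
  rewrite lt_def w0 andbT; apply/eqP => we; move: gw; rewrite we g0 => /eqP.
  by rewrite oner_eq0.
have wle z : 0 <= z -> z <= m -> w * z <= pi / 2.
  move=> z0 zm; have := Wle z z0 zm; have := ler_wpM2r z0 wW; lra.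
by split; [|exact: wle|exact: wle|move: gw; rewrite /g; lra].
Qed.

(* The dumbbell condition says that (cos al, 2 sin al) is q (sin be, cos be). *)
Lemma dumbbell_angle (al be : R) : 0 <= al <= pi / 2 -> 0 <= be <= pi / 2 ->
  cos al * cos be = 2 * (sin al * sin be) ->
  exists q, [/\ 0 < q, cos al = q * sin be & 2 * sin al = q * cos be].
Proof.
move=> ha hb h; have p0 := pi_gt0 R.
have ca : 0 <= cos al by apply: cos_ge0_pihalf; lra.
have cb : 0 <= cos be by apply: cos_ge0_pihalf; lra.
have sa : 0 <= sin al by apply: sin_ge0_pi; lra.
have sb : 0 <= sin be by apply: sin_ge0_pi; lra.
have ea := cos2Dsin2 al; have eb := cos2Dsin2 be.
pose q := cos al * sin be + 2 * (sin al * cos be).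
have q2 : q ^+ 2 = cos al ^+ 2 + 4 * sin al ^+ 2.
  transitivity ((cos al ^+ 2 + 4 * sin al ^+ 2) * (cos be ^+ 2 + sin be ^+ 2)
    - (cos al * cos be - 2 * (sin al * sin be)) ^+ 2); first by rewrite /q; ring.
  by rewrite h eb subrr expr0n mulr1 subr0.
exists q; split.
- rewrite lt_def; apply/andP; split; last first.
    by rewrite /q addr_ge0 ?mulr_ge0.
  rewrite -sqrf_eq0 q2 gt_eqF //; have := sqr_ge0 (sin al); lra.
- transitivity (cos al * (cos be ^+ 2 + sin be ^+ 2)); first by rewrite eb mulr1.
  transitivity ((cos al * cos be) * cos be + cos al * sin be ^+ 2); first by ring.
  by rewrite h /q; ring.
- transitivity (2 * sin al * (cos be ^+ 2 + sin be ^+ 2)); first by rewrite eb mulr1.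
  transitivity (2 * (sin al * sin be) * sin be + 2 * sin al * cos be ^+ 2); first by ring.
  by rewrite -h /q; ring.
Qed.

Lemma is_derive_has_derivative_on (l : R) (f df : R -> R) :
  (forall x : R, is_derive x 1 f (df x)) -> has_derivative_on l f df.
Proof.
move=> h x hx; have /is_derive1_caratheodory[g [fg cg gx]] := h x.
move=> U hU.
suff : \forall z \near x, z != x -> `[0, l]%classic z ->
      U ((f z - f x) / (z - x)) by [].
have : \forall z \near x, U (g z) by apply: cg; rewrite gx.
by apply: filterS => z hz zx _; rewrite fg mulfK // subr_eq0.
Qed.

Variables L V : R.
Hypotheses (V0 : 0 <= V) (VL : V <= L) (L0 : 0 < L).
Variables (w q : R).
Let al := w * ((L - V) / 2).
Let be := w * (V / 4).
Hypotheses (w0 : 0 < w) (hal : 0 <= al <= pi / 2) (hbe : 0 <= be <= pi / 2).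
Hypotheses (q0 : 0 < q) (hq1 : cos al = q * sin be) (hq2 : 2 * sin al = q * cos be).

Definition dumbbell_sign (b : bool) : R := if b then 1 else -1.

(** Odd about the midpoint of the handle, and on each loop symmetric about the point opposite the
    vertex. The amplitude q / 2 makes [hq2] the continuity and [hq1] the Kirchhoff condition, the
    two ends of a loop contributing equally. *)
Definition dumbbell_fun (o : option bool) (x : R) : R :=
  if o is Some b then dumbbell_sign b * (q / 2) * cos (w * (x - V / 4))
  else sin (w * (x - (L - V) / 2)).

Definition dumbbell_dfun (o : option bool) (x : R) : R :=
  if o is Some b then dumbbell_sign b * (q / 2) * (- sin (w * (x - V / 4)) * w)
  else cos (w * (x - (L - V) / 2)) * w.

Lemma is_derive_affine (z x : R) : is_derive x 1 (fun x : R => w * (x - z)) w.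
Proof.
have h := @is_deriveZ R _ _ _ w x 1 _
  (is_deriveB (is_derive_id x 1) (is_derive_cst z x 1)).
by apply: (is_derive_eq h); rewrite /GRing.scale /= subr0 mulr1.
Qed.

Lemma is_derive_dumbbell_fun o (x : R) :
  is_derive x 1 (dumbbell_fun o) (dumbbell_dfun o x).
Proof.
case: o => [b|]; last first.
  exact: @is_derive1_comp R sin _ x _ _ (is_derive_sin _) (is_derive_affine _ x).
have h := @is_derive1_comp R cos _ x _ _ (is_derive_cos _) (is_derive_affine (V / 4) x).
exact: @is_deriveZ R _ _ _ (dumbbell_sign b * (q / 2)) x 1 _ h.
Qed.

Lemma is_derive_dumbbell_dfun o (x : R) :
  is_derive x 1 (dumbbell_dfun o) (- (w ^+ 2 * dumbbell_fun o x)).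
Proof.
case: o => [b|]; last first.
  have h := @is_derive1_comp R cos _ x _ _ (is_derive_cos _)
    (is_derive_affine ((L - V) / 2) x).
  have h' := is_deriveM h (is_derive_cst w x 1).
  by apply: (is_derive_eq h'); rewrite /GRing.scale /=; ring.
have h := @is_derive1_comp R sin _ x _ _ (is_derive_sin _) (is_derive_affine (V / 4) x).
have h' := is_deriveM (is_deriveN h) (is_derive_cst w x 1).
have h2 := @is_deriveZ R _ _ _ (dumbbell_sign b * (q / 2)) x 1 _ h'.
by apply: (is_derive_eq h2); rewrite /GRing.scale /=; ring.
Qed.

Let D := dumbbell L V.

Lemma dumbbell_in_eigenspace :
  in_eigenspace (w ^+ 2) (fun e : edge D => dumbbell_fun (val e)).
Proof.
have V0' := V0; have VL' := VL.
(* In the figure-8 both ends of the handle are one vertex, so the values sin al and - sin al have to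
   agree. *)
have hdeg : ~~ (V < L) -> al = 0.
  by rewrite -leNgt => LV; rewrite /al (_ : L - V = 0); [ring|lra].
pose s (o : option bool) := dumbbell_end L V (if o is Some b then b else false).
pose t (o : option bool) := dumbbell_end L V (if o is Some b then b else true).
have sE (e : edge D) : src e = s (val e) by case: e => -[].
have tE (e : edge D) : tgt e = t (val e) by case: e => -[].
exists (fun e : edge D => dumbbell_dfun (val e)); split.
- by move=> e; apply: is_derive_has_derivative_on => x; exact: is_derive_dumbbell_fun.
- by move=> e; apply: is_derive_has_derivative_on => x; exact: is_derive_dumbbell_dfun.
- pose phi (v : 'I_(V < L)%R.+1) := if v == ord_max then sin al else - sin al.
  have phiE b : phi (dumbbell_end L V b) = dumbbell_sign b * sin al.
    case: b; rewrite /phi /dumbbell_sign /= ?eqxx ?mul1r // mulN1r.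
    case: eqP => // h; have : nat_of_bool (V < L) = 0%N.
      by rewrite -[LHS]/(val (@ord_max (V < L)%R)) -h.
    by case: (boolP (V < L)) => // /hdeg -> _; rewrite sin0 oppr0.
  exists phi => e; have -> : len e = dumbbell_len L V (val e) by [].
  rewrite sE tE; case: (val e) => [b|]; rewrite /s /t !phiE /=.
    rewrite (_ : w * (0 - V / 4) = - be); last by rewrite /be; ring.
    rewrite (_ : w * (V / 2 - V / 4) = be); last by rewrite /be; field.
    rewrite cosN; split; rewrite -mulrA; congr (_ * _); have := hq2; lra.
  rewrite (_ : w * (0 - (L - V) / 2) = - al); last by rewrite /al; ring.
  rewrite (_ : w * (L - V - (L - V) / 2) = al); last by rewrite /al; field.
  by rewrite sinN /= mulN1r mul1r.
- move=> v.
  pose K o := (s o == v)%:R * dumbbell_dfun o 0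
    - (t o == v)%:R * dumbbell_dfun o (dumbbell_len L V o).
  transitivity (\sum_(e : edge D) K (val e)).
    rewrite sumrB big_mkcond [X in _ + X]big_mkcond -sumrN; congr (_ + _);
      apply: eq_bigr => e _; rewrite ?sE ?tE; case: eqP => _;
      by rewrite ?mul1r ?mul0r ?oppr0.
  have K1 b : K (Some b) = (dumbbell_end L V b == v)%:R * (dumbbell_sign b * w * cos al).
    rewrite /K /s /t /= -mulrBr.
    rewrite (_ : w * (0 - V / 4) = - be); last by rewrite /be; ring.
    rewrite (_ : w * (V / 2 - V / 4) = be); last by rewrite /be; field.
    by rewrite sinN hq1; field.
  have K0 : K None = ((dumbbell_end L V false == v)%:R
      - (dumbbell_end L V true == v)%:R) * (w * cos al).
    rewrite /K /s /t /=.
    rewrite (_ : w * (0 - (L - V) / 2) = - al); last by rewrite /al; ring.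
    rewrite (_ : w * (L - V - (L - V) / 2) = al); last by rewrite /al; field.
    by rewrite cosN; ring.
  (* The dropped edges contribute nothing: a handle of length zero has both ends at one vertex, and
     for loops of length zero be = 0 gives cos al = 0. *)
  transitivity (\sum_o K o).
    rewrite (sum_sig (fun o => 0 < dumbbell_len L V o) K).
    rewrite big_mkcond; apply: eq_bigr => o _; case: ifP => // /negbT.
    rewrite -leNgt; case: o => [b|] /= ho; last first.
      rewrite K0; suff -> : dumbbell_end L V false = dumbbell_end L V true.
        by rewrite subrr mul0r.
      have LV : (V < L) = false by apply/negbTE; rewrite -leNgt -subr_le0.
      by apply/val_inj; rewrite /= LV.
    rewrite K1 hq1 (_ : be = 0) ?sin0 ?mulr0 //.
    by rewrite /be (_ : V = 0) ?mul0r ?mulr0 //; lra.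
  rewrite (bigD1 None) // (bigD1 (Some true)) //= (bigD1 (Some false)) //=.
  rewrite big1 => [|[[]|]] //.
  by rewrite K0 !K1 /dumbbell_sign; ring.
Qed.

Lemma dumbbell_eigenvalue_le : (eigenvalue_k D 2 <= (w ^+ 2)%:E)%E.
Proof.
have [VL' [V0' L0']] : V <= L /\ 0 <= V /\ 0 < L by [].
have p0 := pi_gt0 R.
apply: ereal_inf_lbound; exists (w ^+ 2) => //.
pose f (e : edge D) := dumbbell_fun (val e).
exists (fun i : 'I_2 => if i == ord0 then fun _ _ => 1 else f).
exists (fun i : 'I_2 => if i == ord0 then 0 else w ^+ 2); split.
- move=> k hk.
  have {}hk e x : 0 <= x <= len e -> k ord0 + k ord_max * f e x = 0.
    by move=> /hk; rewrite !big_ord_recl big_ord0 /= mulr1 addr0 => <-;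
       congr (_ + k _ * _); exact/val_inj.
  (* Independence from the constant only needs two different values: those at the ends of the handle
     if V < L, those at the midpoints of the two loops otherwise. *)
  have [e1 [x1 [e2 [x2 [h1 h2 ne]]]]] : exists (e1 : edge D) x1 (e2 : edge D) x2,
      [/\ 0 <= x1 <= len e1, 0 <= x2 <= len e2 & f e1 x1 != f e2 x2].
    have [VL2|LV] := ltP V L.
      have he : 0 < dumbbell_len L V None by rewrite /= subr_gt0.
      pose e : edge D := exist _ None he.
      have le0 : 0 <= L - V by rewrite subr_ge0.
      exists e, 0, e, (L - V); rewrite /= !lexx le0; split => //.
      rewrite /f /= (_ : w * (0 - (L - V) / 2) = - al); last by rewrite /al; ring.
      rewrite (_ : w * (L - V - (L - V) / 2) = al); last by rewrite /al; field.
      rewrite sinN; have al0 : 0 < al by rewrite /al mulr_gt0 // divr_gt0 // subr_gt0.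
      have : 0 < sin al by apply: sin_gt0_pi; have := hal; lra.
      by move=> sa; rewrite lt_eqF //; lra.
    have he b : 0 < dumbbell_len L V (Some b) by rewrite /=; lra.
    pose e b : edge D := exist _ (Some b) (he b).
    exists (e false), (V / 4), (e true), (V / 4); rewrite /=.
    have hV : 0 <= V / 4 <= V / 2 by lra.
    split => //; rewrite /f /= subrr mulr0 cos0 lt_eqF // /dumbbell_sign.
    by have := q0; lra.
  have k1 : k ord_max = 0.
    have /addrI/eqP := etrans (hk _ _ h1) (esym (hk _ _ h2)).
    by rewrite -subr_eq0 -mulrBr mulf_eq0 subr_eq0 (negbTE ne) orbF => /eqP.
  have k0 : k ord0 = 0 by have := hk _ _ h1; rewrite k1 mul0r addr0.
  move=> i; have [->//|->//] : i = ord0 \/ i = ord_max.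
  by case: i => -[|[|//]] hi; [left|right]; exact/val_inj.
- move=> i; case: ifP => _; split => //; last exact: dumbbell_in_eigenspace.
  + exists (fun _ _ => 0); split.
    * by move=> e; apply: is_derive_has_derivative_on => x; exact: is_derive_cst.
    * move=> e; apply: is_derive_has_derivative_on => x.
      by rewrite mul0r oppr0; exact: is_derive_cst.
    * by exists (fun=> 1).
    * by move=> v; rewrite !big1 ?addr0 // => e _; rewrite oppr0.
  + exact: sqr_ge0.
Qed.

End DumbbellEigenvalue.

(** * Comparison of the two frequencies *)

Theorem theorem6p3 (R : realType) (G : metric_graph R) (L V : R)
    (hconn : connected_graph G)
    (hL : total_length G = L)
    (hV : doubly_connected_length G = V) :
  (eigenvalue_k (dumbbell L V) 2 <= eigenvalue_k G 2)%E.
Proof.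
apply: le_ereal_inf_tmp => _ [mu [u [lam [hu hlam]]] <-].
have [i [lam0 [e [x [hx ux]]]]] : exists i, 0 < lam i /\
    exists e x, 0 <= x <= len e /\ u i e x != 0.
  have sum1 (i : 'I_2) (F : 'I_2 -> R) : \sum_(j < 2) (j == i)%:R * F j = F i.
    rewrite (bigD1 i) //= eqxx mul1r big1 ?addr0 // => j /negbTE ->.
    by rewrite mul0r.
  have nz i : exists e x, 0 <= x <= len e /\ u i e x != 0.
    apply: contrapT => no.
    have h (e : edge G) x : 0 <= x <= len e -> \sum_(j < 2) (j == i)%:R * u j e x = 0.
      move=> hx; rewrite sum1; apply/eqP/negPn/negP => h.
      by apply: no; exists e, x.
    by have /eqP := hu _ h i; rewrite eqxx oner_eq0.
  apply: contrapT => no.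
  have hc i : exists c, forall e x, 0 <= x <= len e -> u i e x = c.
    apply: (eigenfunction_const hconn _ (hlam i).1).
    by rewrite leNgt; apply/negP => li; apply: no; exists i.
  have [c hc'] := choice hc.
  (* Two constant functions satisfy the relation c1 u0 - c0 u1 = 0; independence then gives c1 = 0,
     although u1 is nonzero. *)
  pose d (j : 'I_2) : R := if j == ord0 then c ord_max else - c ord0.
  have d0 : d ord0 = 0.
    apply: (hu d) => e x hx; rewrite !big_ord_recl big_ord0 /= !hc' // /d /=.
    rewrite (_ : lift _ _ = ord_max); last exact/val_inj.
    by ring.
  have [e [x [hx]]] := nz ord_max.
  by rewrite hc' //; move: d0; rewrite /d eqxx => ->; rewrite eqxx.
have [hi lmu] := hlam i.
have len0 (f : edge G) : 0 <= len f by exact: ltW (len_gt0 f).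
have V0 : 0 <= V by rewrite -hV; apply: sumr_ge0.
have VL : V <= L.
  rewrite -hV -hL /doubly_connected_length big_mkcond; apply: ler_sum => f _.
  by case: ifP.
have L0 : 0 < L.
  rewrite -hL /total_length (bigD1 e) //= ltr_pwDl ?len_gt0 //.
  exact: sumr_ge0.
have a0 : 0 <= (L - V) / 2 by lra.
have b0 : 0 <= V / 4 by lra.
have ab0 : 0 < (L - V) / 2 + V / 4 by lra.
have [w [w0 wa wb hw]] := dumbbell_frequency a0 b0 ab0.
set al := w * ((L - V) / 2) in wa hw; set be := w * (V / 4) in wb hw.
have hal : 0 <= al <= pi / 2 by rewrite wa andbT mulr_ge0 // ltW.
have hbe : 0 <= be <= pi / 2 by rewrite wb andbT mulr_ge0 // ltW.
have [q [q0 hq1 hq2]] := dumbbell_angle hal hbe hw.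
apply: (le_trans (dumbbell_eigenvalue_le V0 VL L0 w0 hal q0 hq1 hq2)).
rewrite lee_fin; apply: le_trans lmu.
pose r := Num.sqrt (lam i).
have r0 : 0 < r by rewrite sqrtr_gt0.
have r2 : r ^+ 2 = lam i by rewrite sqr_sqrtr // ltW.
rewrite -r2 ler_pXn2r ?nnegrE ?(ltW w0) ?(ltW r0) //.
have p0 := pi_gt0 R.
(* [hq1] and [hq2] say that (cos al, 2 sin al) is q times the unit vector of argument pi / 2 -
   be. *)
have hd : double_tan al = pi / 2 - be.
  rewrite /double_tan hq1 hq2 ang_scale // -[RHS]ang_cos_sin; last by lra.
  by rewrite cosB sinB cos_pihalf sin_pihalf; congr ang; ring.
have hi' : in_eigenspace (r ^+ 2) (u i) by rewrite r2.
have := eigenfunction_length_bound hconn r0 hi'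
  (ex_intro _ e (ex_intro _ x (conj hx ux))) hal.
rewrite hL hV hd (_ : 2 * _ = w * (L - V + calib_slope al / 2 * V)); last first.
  by rewrite {1}/al /be; field.
rewrite ler_pM2r //.
(* The common factor is positive: it is at least L - V + V / 4, since [calib_slope] is at least 1 /
   2. *)
have s1 : 0 <= (calib_slope al / 2 - 1 / 4) * V.
  by apply: mulr_ge0 => //; have := calib_slope_ge al; lra.
have -> : L - V + calib_slope al / 2 * V
  = L - V + V / 4 + (calib_slope al / 2 - 1 / 4) * V by field.
lra.
Qed.
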